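(* Let $\omega=\omega(n)\to\infty$. With $S_1,S_2,S_3$ as in the context, define $$\hat p=\frac{S_2-\omega\sqrt{S_2}-2S_2^2n^{-2}}{2\binom n2},$$ and define $\hat p_2,\hat p_3$ as follows: if $S_3\gg\sqrt{S_1}$ and $\omega^2\ll S_3/\sqrt{S_1}$, then $$\hat p_2=\frac{S_1-3S_3-\omega\sqrt{S_1}-2S_1^2n^{-2}}{2\binom n2},\qquad \hat p_3=\frac{S_3-\omega\sqrt{S_1}-6S_3^2n^{-3}}{\binom n3};$$ if $S_3=O(\sqrt{S_1})$, then $$\hat p_2=\frac{S_1-\omega\sqrt{S_1}-2S_1^2n^{-2}}{2\binom n2},\qquad \hat p_3=0.$$ If $S_1\to\infty$ and $S_1=o(n^2)$, then for every increasing graph property $\mathcal A$, $$\liminf_{n\to\infty}\Pr\{G_2(n,\hat p)\in\mathcal A\}\le\limsup_{n\to\infty}\Pr\{\mathcal G(n,m,\overline p)\in\mathcal A\}$$ and $$\liminf_{n\to\infty}\Pr\{G_2(n,\hat p_2)\cup G_3(n,\hat p_3)\in\mathcal A\}\le\limsup_{n\to\infty}\Pr\{\mathcal G(n,m,\overline p)\in\mathcal A\}.$$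
   Context: All limits are as $n\to\infty$. Let $\mathcal V=\{v_1,\dots,v_n\}$, $m=m(n)$ a positive integer, and $\overline p=\overline p(n)=(p_1,\dots,p_m)$ with $p_i\in(0,1)$. The random intersection graph $\mathcal G(n,m,\overline p)$ has vertex set $\mathcal V$ and a feature set $\{w_1,\dots,w_m\}$; each vertex $v$ adds feature $w_i$ to its feature set $W(v)$ with probability $p_i$, independently over all vertices and features; two distinct vertices $v,v'$ are adjacent iff $W(v)\cap W(v')\neq\emptyset$. Define $S_1=\sum_{i=1}^m np_i(1-(1-p_i)^{n-1})$, $S_2=\sum_{i=1}^m np_i\left(1-\frac{1-(1-2p_i)^n}{2np_i}\right)$, $S_3=\sum_{i=1}^m np_i\left(\frac{1-(1-2p_i)^n}{2np_i}-(1-p_i)^{n-1}\right)$. For $\hat p\in[0,1]$ and $i\ge2$, $H_i(n,\hat p)$ is the random $i$-uniform hypergraph on $\mathcal V$ in which each $i$-element subset is a hyperedge independently with probability $\hat p$, and $G_i(n,\hat p)$ is the graph on $\mathcal V$ whose edges are the pairs contained in at least one hyperedge of $H_i(n,\hat p)$ (so $G_2(n,\hat p)$ is the binomial random graph). A union $G_2(n,\cdot)\cup G_3(n,\cdot)$ is of independent random graphs on the same vertex set. A graph property (a family of graphs on $\mathcal V$ closed under isomorphism) $\mathcal A$ is increasing if $G\in\mathcal A$ and $E(G)\subseteq E(G')$ imply $G'\in\mathcal A$. Notation $a\ll b$ means $a=o(b)$. *)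

(* Defs.v *)
From HB Require Import structures.
From mathcomp Require Import all_boot all_order all_fingroup all_algebra.
From mathcomp Require Import all_classical all_reals all_analysis.
Import Order.TTheory GRing.Theory Num.Theory.
Import numFieldNormedType.Exports.

Set Implicit Arguments.
Unset Strict Implicit.
Unset Printing Implicit Defensive.

Local Open Scope ring_scope.

Record sgraph (V : finType) := SGraph {
  edges : {set {set V}};
  edges_card2 : [forall e in edges, #|e| == 2%N] }.

HB.instance Definition _ (V : finType) := [isSub for @edges V].
HB.instance Definition _ (V : finType) := [Finite of sgraph V by <:].

Section Graphs.
Variable V : finType.
Implicit Types (G : sgraph V) (A : {set sgraph V}) (r : rel V).

Definition rel_edges r : {set {set V}} :=
  [set [set x; y] | x in [set: V], y in [set: V] & (x != y) && r x y]%SET.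

Lemma rel_edges_card2 r : [forall e in rel_edges r, #|e| == 2%N].
Proof.
apply/forall_inP => e /imset2P[x y _]; rewrite inE => /andP[_ /andP[xy _]] ->.
by rewrite cards2 xy.
Qed.

Definition sgraph_of_rel r : sgraph V := SGraph (rel_edges_card2 r).

Lemma sgraphU_card2 G H : [forall e in edges G :|: edges H, #|e| == 2%N].
Proof.
apply/forall_inP => e; rewrite inE => /orP[].
- exact: (forall_inP (edges_card2 G)).
- exact: (forall_inP (edges_card2 H)).
Qed.

Definition sgraphU G H : sgraph V := SGraph (sgraphU_card2 G H).

Definition isomorphic G H : Prop :=
  exists s : {perm V}, edges H = [set s @: e | e : {set V} in edges G]%SET.

Definition graph_property A : Prop :=
  forall G H, isomorphic G H -> G \in A -> H \in A.

Definition increasing A : Prop :=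
  forall G H, edges G \subset edges H -> G \in A -> H \in A.

(* The graph on V whose edges are the pairs contained in a hyperedge of H. *)
Definition shadow (H : {set {set V}}) : sgraph V :=
  sgraph_of_rel (fun x y => [exists e in H, [set x; y]%SET \subset e]).

(* [W v] is the feature set of v. *)
Definition intersection_graph (F : finType) (W : V -> {set F}) : sgraph V :=
  sgraph_of_rel (fun x y => (W x :&: W y)%SET != finset.set0).

End Graphs.

Section Probability.
Variable R : realType.

(* Law of the random subset of T that contains each x : T independently with
   probability q x. *)
Definition bernoulli_law (T : finType) (q : T -> R) (B : {set T}) : R :=
  \prod_(x : T) (if x \in B then q x else 1 - q x).

Lemma bernoulli_law_ge0 (T : finType) (q : T -> R) B :
  (forall x, 0 <= q x <= 1) -> 0 <= bernoulli_law q B.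
Proof.
move=> q01; apply: prodr_ge0 => x _; have /andP[q0 q1] := q01 x.
by case: ifP; rewrite ?subr_ge0.
Qed.

Lemma bernoulli_law_sum1 (T : finType) (q : T -> R) :
  \sum_(B : {set T}) bernoulli_law q B = 1.
Proof.
have -> : 1 = \prod_(x : T) (q x + (1 - q x)).
  by rewrite big1 // => x _; rewrite addrC subrK.
by rewrite bigA_distr.
Qed.

(* Pr{G(n,m,p) \in A}: the random set B holds the pairs (v, w) such that the
   vertex v adds the feature w; its law makes these events independent, with
   probability p w. *)
Definition Pr_RIG (n m : nat) (p : 'I_m -> R) (A : {set sgraph 'I_n}) : R :=
  \sum_(B : {set 'I_n * 'I_m} |
        intersection_graph (fun v => [set w | (v, w) \in B]%SET) \in A)
     bernoulli_law (fun vw => p vw.2) B.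

(* Law of H_i(n,p): a subset of V of size i is a hyperedge with probability p,
   and no subset of another size is one. *)
Definition hypergraph_law (n i : nat) (p : R) : {set {set 'I_n}} -> R :=
  bernoulli_law (fun e : {set 'I_n} => if #|e| == i then p else 0).

(* Pr{G_2(n,p) \in A} *)
Definition Pr_G2 (n : nat) (p : R) (A : {set sgraph 'I_n}) : R :=
  \sum_(H : {set {set 'I_n}} | shadow H \in A) hypergraph_law 2 p H.

(* Pr{G_2(n,p2) \cup G_3(n,p3) \in A}, the two graphs being independent *)
Definition Pr_G2UG3 (n : nat) (p2 p3 : R) (A : {set sgraph 'I_n}) : R :=
  \sum_(HK : {set {set 'I_n}} * {set {set 'I_n}} |
        sgraphU (shadow HK.1) (shadow HK.2) \in A)
     hypergraph_law 2 p2 HK.1 * hypergraph_law 3 p3 HK.2.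

(* Projection onto [0, 1], so that a real expression can be used as a
   probability for every n. *)
Definition clamp01 (x : R) : R := Num.max 0 (Num.min x 1).

Lemma clamp01_id (x : R) : 0 <= x <= 1 -> clamp01 x = x.
Proof. by case/andP=> x0 x1; rewrite /clamp01 min_l // max_r. Qed.

Definition S1 (n m : nat) (p : 'I_m -> R) : R :=
  \sum_(i < m) n%:R * p i * (1 - (1 - p i) ^+ n.-1).

Definition S2 (n m : nat) (p : 'I_m -> R) : R :=
  \sum_(i < m) n%:R * p i *
    (1 - (1 - (1 - 2 * p i) ^+ n) / (2 * n%:R * p i)).

Definition S3 (n m : nat) (p : 'I_m -> R) : R :=
  \sum_(i < m) n%:R * p i *
    ((1 - (1 - 2 * p i) ^+ n) / (2 * n%:R * p i) - (1 - p i) ^+ n.-1).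

End Probability.

(* Main.v *)
Require Import Defs.
From HB Require Import structures.
From mathcomp Require Import all_boot all_order all_fingroup all_algebra.
From mathcomp Require Import all_classical all_reals all_analysis.
From mathcomp Require Import ring lra zify.
Import Order.TTheory GRing.Theory Num.Theory.
Import numFieldNormedType.Exports.

(* Idea. Let X_w be the number of holders of the feature w. The holders span a
   clique, and this clique stochastically dominates any collection of independent
   uniform pairs and triples whose union always has at most X_w vertices: apply a
   uniform permutation of the vertices that depends on w only. Use floor(X_w / 2)
   pairs, or, when X_w >= 3 is odd, (X_w - 3) / 2 pairs and one triple. The total
   numbers of pairs and triples have means S2 / 2, respectively (S1 - 3 S3) / 2 and
   S3, and variances O(S1), so that by Chebyshev they fall short of their means by
   more than d = C sqrt(S1) with probability O(1 / C^2). Among t independent uniform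
   k-sets at least t - t^2 / 'C(n, k) - d are distinct, up to an event of probability
   t / d^2, which explains the terms S^2 / n^2 and S^2 / n^3 in the edge probabilities;
   by symmetry again, these distinct k-sets dominate a binomial random hypergraph with
   fewer hyperedges. Hence the probabilities compare up to 20 / C^2 as soon as omega
   exceeds a multiple of C, and C is arbitrary. *)

Set Implicit Arguments.
Unset Strict Implicit.
Unset Printing Implicit Defensive.

Local Open Scope ring_scope.

(** * Product laws *)

Section ProductLaw.
Variables (R : realType) (I J : finType) (mu : I -> J -> R).
Hypothesis mu_sum1 : forall i, \sum_j mu i j = 1.

Definition prod_law (g : {ffun I -> J}) : R := \prod_i mu i (g i).

Lemma prod_law_prod (h : I -> J -> R) :
  \sum_g prod_law g * \prod_i h i (g i) = \prod_i \sum_j mu i j * h i j.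
Proof.
rewrite bigA_distr_bigA /=; apply: eq_bigr => g _.
by rewrite -big_split.
Qed.

Lemma prod_law_sum1 : \sum_g prod_law g = 1.
Proof.
transitivity (\prod_i \sum_j mu i j); first by rewrite bigA_distr_bigA.
by rewrite big1.
Qed.

Lemma prod_law_ge0 g : (forall i j, 0 <= mu i j) -> 0 <= prod_law g.
Proof. by move=> mu0; apply: prodr_ge0. Qed.

Lemma prod_law1 i (f : J -> R) :
  \sum_g prod_law g * f (g i) = \sum_j mu i j * f j.
Proof.
(* A function of one coordinate is a product over all coordinates with factors 1 elsewhere. *)
transitivity (\sum_g prod_law g * \prod_k (if k == i then f (g k) else 1)).
  by apply: eq_bigr => g _; rewrite -big_mkcond big_pred1_eq.
rewrite (prod_law_prod (fun k j => if k == i then f j else 1)) (bigD1 i) //=.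
rewrite eqxx [X in _ * X]big1 ?mulr1 // => k /negbTE ki.
by under eq_bigr do rewrite ki mulr1.
Qed.

Lemma prod_law2 i k (f h : J -> R) : i != k ->
  \sum_g prod_law g * (f (g i) * h (g k)) =
  (\sum_j mu i j * f j) * (\sum_j mu k j * h j).
Proof.
move=> ik.
pose u l j := if l == i then f j else if l == k then h j else 1.
transitivity (\sum_g prod_law g * \prod_l u l (g l)).
  apply: eq_bigr => g _; rewrite (bigD1 i) //= /u eqxx (bigD1 k) /=; last by rewrite eq_sym.
  rewrite eq_sym (negbTE ik) eqxx big1 ?mulr1 // => l /andP[/negbTE -> /negbTE ->] //.
rewrite prod_law_prod (bigD1 i) //= (bigD1 k) /=; last by rewrite eq_sym.
rewrite {1 2}/u eqxx eq_sym (negbTE ik) eqxx [X in _ * (_ * X)]big1 ?mulr1 // => l /andP[li lk].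
by rewrite /u (negbTE li) (negbTE lk); under eq_bigr do rewrite mulr1.
Qed.

(** The coordinates are independent, so distinct centred terms are uncorrelated and only the
    diagonal of the expanded square survives. *)
Lemma prod_law_var (f : I -> J -> R) :
  let e i := \sum_j mu i j * f i j in
  \sum_g prod_law g * (\sum_i f i (g i) - \sum_i e i) ^+ 2 =
  \sum_i \sum_j mu i j * (f i j - e i) ^+ 2.
Proof.
move=> e.
have e0 i : \sum_j mu i j * (f i j - e i) = 0.
  under eq_bigr do rewrite mulrBr.
  by rewrite big_split /= sumrN -mulr_suml mu_sum1 mul1r subrr.
transitivity (\sum_i \sum_k \sum_g prod_law g * ((f i (g i) - e i) * (f k (g k) - e k))).
  apply/esym; under eq_bigr do rewrite exchange_big /=.
  rewrite exchange_big /=; apply: eq_bigr => g _.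
  under eq_bigr do rewrite -mulr_sumr -mulr_sumr.
  by rewrite -mulr_sumr -mulr_suml -sumrB expr2.
apply: eq_bigr => i _; rewrite (bigD1 i) //= [X in _ + X]big1 ?addr0.
  exact: (prod_law1 i (fun j => (f i j - e i) ^+ 2)).
move=> k ki; rewrite eq_sym in ki.
by rewrite (prod_law2 (fun j => f i j - e i) (fun j => f k j - e k) ki) e0 mul0r.
Qed.

End ProductLaw.

(** * Second-moment inequalities *)

Section Chebyshev.
Variables (R : realType) (X : finType) (mu : X -> R).
Hypothesis mu_ge0 : forall x, 0 <= mu x.

Lemma markov_sqr (P : pred X) (f : X -> R) (c d : R) : 0 < d ->
  (forall x, P x -> d <= `|f x - c|) ->
  \sum_(x | P x) mu x <= (\sum_x mu x * (f x - c) ^+ 2) / d ^+ 2.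
Proof.
move=> d0 Pd; rewrite ler_pdivlMr ?exprn_gt0 // mulr_suml [X in X <= _]big_mkcond /=.
apply: ler_sum => x _; case: ifPn => Px; last by rewrite mulr_ge0 ?sqr_ge0.
apply: ler_wpM2l => //; rewrite -(real_normK (num_real (f x - c))).
by rewrite ler_sqr ?nnegrE ?(ltW d0) ?normr_ge0 // Pd.
Qed.

(** From [(u + v)^2 <= 2 u^2 + 2 v^2]; this avoids the covariance of [f] and [g]. *)
Lemma variance_sum2 (f g : X -> R) (a b : R) :
  \sum_x mu x * (f x + g x - (a + b)) ^+ 2 <=
  2 * \sum_x mu x * (f x - a) ^+ 2 + 2 * \sum_x mu x * (g x - b) ^+ 2.
Proof.
rewrite !mulr_sumr -big_split /=; apply: ler_sum => x _.
rewrite !(mulrCA 2) -mulrDr; apply: ler_wpM2l => //.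
have := sqr_ge0 (f x - a - (g x - b)); nra.
Qed.

Lemma variance_le (f : X -> R) : \sum_x mu x = 1 ->
  \sum_x mu x * (f x - \sum_y mu y * f y) ^+ 2 <= \sum_x mu x * f x ^+ 2.
Proof.
move=> mu1; set e := \sum_y mu y * f y.
rewrite (eq_bigr (fun x => mu x * f x ^+ 2 - 2 * e * (mu x * f x) + e ^+ 2 * mu x));
  last by move=> x _; ring.
rewrite big_split /= sumrB -!mulr_sumr mu1 -/e.
have := sqr_ge0 e; nra.
Qed.

End Chebyshev.

(** * Coupling by symmetry *)

Section Coupling.
Variables (R : realType) (S X Y : finType) (mu : X -> R) (nu : Y -> R).
Hypotheses (mu_ge0 : forall x, 0 <= mu x) (nu_ge0 : forall y, 0 <= nu y).
Hypotheses (mu_sum1 : \sum_x mu x = 1) (nu_sum1 : \sum_y nu y = 1).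

(* S acts as a group of symmetries of both laws: f s x y and g s y are the
   values of the compared functionals at the images of x and y under s. The
   image of x may be taken in a way that depends on y. *)
Lemma symmetric_coupling (f : S -> X -> Y -> R) (g : S -> Y -> R) (a b : R)
    (good : X -> Y -> bool) : (0 < #|S|)%N ->
  (forall s x y, f s x y <= 1) -> (forall s y, 0 <= g s y) ->
  (forall s y, \sum_x mu x * f s x y = a) ->
  (forall s, \sum_y nu y * g s y = b) ->
  (forall x y, good x y -> \sum_s f s x y <= \sum_s g s y) ->
  a <= b + \sum_x \sum_(y | ~~ good x y) mu x * nu y.
Proof.
move=> S0 f1 g0 Ef Eg fg; have S0R : 0 < #|S|%:R :> R by rewrite ltr0n.
rewrite -(ler_pM2l S0R) mulrDr.
have -> : #|S|%:R * a = \sum_x \sum_y mu x * nu y * \sum_s f s x y.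
  transitivity (\sum_s \sum_y nu y * \sum_x mu x * f s x y).
    under eq_bigr do under eq_bigr do rewrite Ef.
    by under eq_bigr do rewrite -mulr_suml nu_sum1 mul1r; rewrite sumr_const mulr_natl.
  under eq_bigr do under eq_bigr do rewrite mulr_sumr.
  under eq_bigr do rewrite exchange_big /=.
  rewrite exchange_big /=; apply: eq_bigr => x _.
  rewrite exchange_big /=; apply: eq_bigr => y _.
  by rewrite mulr_sumr; apply: eq_bigr => s _; rewrite mulrCA mulrA.
have -> : #|S|%:R * b = \sum_x \sum_y mu x * nu y * \sum_s g s y.
  transitivity (\sum_(s in S) \sum_y nu y * g s y).
    by under eq_bigr do rewrite Eg; rewrite sumr_const mulr_natl.
  under [RHS]eq_bigr do under eq_bigr do rewrite -mulrA.
  under [RHS]eq_bigr do rewrite -mulr_sumr.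
  rewrite -mulr_suml mu_sum1 mul1r exchange_big /=.
  by apply: eq_bigr => y _; rewrite mulr_sumr.
rewrite mulr_sumr -big_split /=; apply: ler_sum => x _.
rewrite mulr_sumr [X in _ <= _ + X]big_mkcond -big_split /=; apply: ler_sum => y _.
have mn0 : 0 <= mu x * nu y by rewrite mulr_ge0.
have [/fg fgxy|_] /= := boolP (good x y); first by rewrite addr0 ler_wpM2l.
(* Off [good] the sum of [f] over [S] is at most [#|S|], which is exactly what the error term
   pays. *)
rewrite [X in _ <= _ + X]mulrC -mulrDr; apply: ler_wpM2l => //.
apply: le_trans (ler_wpDl _ (lexx _)); last exact: sumr_ge0.
apply: (@le_trans _ _ (\sum_(s in S) 1)); first exact: ler_sum.
by rewrite sumr_const.
Qed.

Lemma union_bound2 (bad : X -> Y -> bool) (P : pred X) (Q : pred Y) :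
  (forall x y, bad x y -> P x || Q y) ->
  \sum_x \sum_(y | bad x y) mu x * nu y <= \sum_(x | P x) mu x + \sum_(y | Q y) nu y.
Proof.
move=> badPQ.
have -> : \sum_(x | P x) mu x + \sum_(y | Q y) nu y =
    \sum_x \sum_y ((if P x then mu x * nu y else 0) + (if Q y then mu x * nu y else 0)).
  under [RHS]eq_bigr do rewrite big_split /=.
  rewrite big_split /=; congr (_ + _).
    rewrite big_mkcond; apply: eq_bigr => x _; case: ifP => _; last by rewrite big1.
    by rewrite -mulr_sumr nu_sum1 mulr1.
  rewrite exchange_big big_mkcond; apply: eq_bigr => y _; case: ifP => _; last by rewrite big1.
  by rewrite -mulr_suml mu_sum1 mul1r.
apply: ler_sum => x _; rewrite big_mkcond; apply: ler_sum => y _.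
have mn0 : 0 <= mu x * nu y by rewrite mulr_ge0.
case: ifPn => [/badPQ/orP[]->|_]; rewrite ?lerDl ?lerDr ?addr_ge0 //;
  by case: ifP.
Qed.

End Coupling.

(** List [U] before its complement, [W] before its complement, and match the two lists by position:
    the elements of [U] land in [W]. *)
Lemma perm_preimset_sub (T : finType) (U W : {set T}) :
  (#|U| <= #|W|)%N -> exists s : {perm T}, s @^-1: U \subset W.
Proof.
move=> UW; pose e (A : {set T}) := enum A ++ enum (~: A).
have eA A x : x \in e A by rewrite mem_cat !mem_enum inE orbN.
have eU A : uniq (e A).
  rewrite cat_uniq !enum_uniq andbT; apply/hasPn => x.
  by rewrite !mem_enum inE.
have es A : size (e A) = #|T| by rewrite size_cat -!cardE cardsC.
pose h x := nth x (e W) (index x (e U)).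
have h_inj : injective h.
  move=> x y; rewrite /h (set_nth_default x y) ?es -?(es U) ?index_mem // => /eqP.
  rewrite nth_uniq ?es -?(es U) ?index_mem // => /eqP ixy.
  by rewrite -(nth_index x (eA U x)) ixy nth_index.
exists (perm h_inj)^-1%g; apply/fintype.subsetP => y; rewrite inE => yU.
have -> : y = h ((perm h_inj)^-1%g y) by rewrite -[RHS](permE h_inj) permKV.
move: ((perm h_inj)^-1%g y) yU => x xU.
have lt : (index x (e U) < #|W|)%N.
  apply: leq_trans UW; rewrite /e index_cat mem_enum xU cardE index_mem.
  by rewrite mem_enum.
by rewrite /h nth_cat -cardE lt -mem_enum mem_nth -?cardE.
Qed.

(** * Random subsets with independent elements *)

Section Bernoulli.
Variables (R : realType) (T : finType).
Implicit Types (q : T -> R) (B : {set T}).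

Lemma bernoulli_law_preim q (k : T -> T) B : injective k ->
  (forall x, q (k x) = q x) -> bernoulli_law q (k @^-1: B) = bernoulli_law q B.
Proof.
move=> k_inj qk; rewrite /bernoulli_law [RHS](reindex_inj k_inj) /=.
by apply: eq_bigr => x _; rewrite inE qk.
Qed.

Lemma preimset_injective (k : T -> T) : injective k ->
  injective (fun B : {set T} => k @^-1: B).
Proof.
move=> k_inj B C /setP eBC; apply/setP => y.
by have := eBC (invF k_inj y); rewrite !inE f_invF.
Qed.

Lemma sum_bernoulli_preim q (k : T -> T) (h : {set T} -> R) : injective k ->
  (forall x, q (k x) = q x) ->
  \sum_B bernoulli_law q B * h (k @^-1: B) = \sum_B bernoulli_law q B * h B.
Proof.
move=> k_inj qk; rewrite [RHS](reindex_inj (preimset_injective k_inj)) /=.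
by apply: eq_bigr => B _; rewrite bernoulli_law_preim.
Qed.

(** A random set is encoded by its indicator, whose bits are independent, so that the results on
    product laws apply. *)
Lemma sum_bernoulli_prod_law q (h : {set T} -> R) :
  \sum_B bernoulli_law q B * h B =
  \sum_g prod_law (fun x (b : bool) => if b then q x else 1 - q x) g
           * h [set x | g x]%SET.
Proof.
rewrite (reindex (fun g : {ffun T -> bool} => [set x | g x]%SET)) /=.
  by apply: eq_bigr => g _; congr (_ * _); apply: eq_bigr => x _; rewrite inE.
exists (fun B : {set T} => [ffun x => x \in B]) => [g _|B _].
- by apply/ffunP => x; rewrite ffunE inE.
- by apply/setP => x; rewrite inE ffunE.
Qed.

Lemma bernoulli_card_var q :
  \sum_B bernoulli_law q B * (#|B|%:R - \sum_x q x) ^+ 2 = \sum_x q x * (1 - q x).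
Proof.
rewrite (sum_bernoulli_prod_law q (fun B : {set T} => (#|B|%:R - \sum_x q x) ^+ 2)).
pose mu x (b : bool) := if b then q x else 1 - q x.
have mu1 x : \sum_b mu x b = 1 by rewrite big_bool /= addrC subrK.
have := prod_law_var mu1 (fun _ b => b%:R).
have e x : \sum_b mu x b * b%:R = q x by rewrite big_bool /= mulr1 mulr0 addr0.
rewrite /= (eq_bigr _ (fun x _ => e x)) => E.
have -> : \sum_x q x * (1 - q x) =
    \sum_x \sum_b mu x b * (b%:R - \sum_b0 mu x b0 * b0%:R) ^+ 2.
  by apply: eq_bigr => x _; rewrite big_bool /= e /mu; ring.
rewrite -E; apply: eq_bigr => g _; congr (_ * (_ - _) ^+ 2).
by rewrite -sum1_card natr_sum big_mkcond; apply: eq_bigr => x _; rewrite inE; case: (g x).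
Qed.

End Bernoulli.

(** * Sampling with replacement *)

Section WithReplacement.
Variables (R : realType) (T : finType) (t : nat).
Hypothesis T_gt0 : (0 < #|T|)%N.
Let N : R := #|T|%:R.

Definition unif_law : {ffun 'I_t -> T} -> R := prod_law (fun _ _ => #|T|%:R^-1).

Let N_gt0 : 0 < N. Proof. by rewrite ltr0n. Qed.
Let N_ge0 : 0 <= N. Proof. exact: ltW. Qed.
Let N_neq0 : N != 0. Proof. by rewrite gt_eqF. Qed.

Lemma unif_law_ge0 e : 0 <= unif_law e.
Proof. by apply: prod_law_ge0 => i j; rewrite invr_ge0. Qed.

Let unif1 (i : 'I_t) : \sum_(x : T) N^-1 = 1.
Proof. by rewrite sumr_const -[LHS]mulr_natr mulVf. Qed.

Lemma unif_law_sum1 : \sum_e unif_law e = 1.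
Proof. exact: prod_law_sum1 (unif1). Qed.

(** All samples have equal weight. Each draw has its own injection because draws assigned to
    different features will be moved by different permutations. *)
Lemma sum_unif_inj (k : 'I_t -> T -> T) (h : {ffun 'I_t -> T} -> R) :
  (forall i, injective (k i)) ->
  \sum_e unif_law e * h [ffun i => k i (e i)] = \sum_e unif_law e * h e.
Proof.
move=> k_inj.
have inj : injective (fun e : {ffun 'I_t -> T} => [ffun i => k i (e i)]).
  by move=> e e' /ffunP ee'; apply/ffunP => i; have := ee' i; rewrite !ffunE => /k_inj.
rewrite [RHS](reindex_inj inj) /=; apply: eq_bigr => e _; congr (_ * _).
Qed.

Let unif_avoid (D : {set T}) :
  \sum_e unif_law e * (\prod_i (e i \notin D)%:R) = (1 - #|D|%:R / N) ^+ t.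
Proof.
rewrite (prod_law_prod _ (fun _ x => (x \notin D)%:R)) prodr_const card_ord; congr (_ ^+ _).
have cD : N = \sum_x (x \notin D)%:R + #|D|%:R.
  rewrite /N -[#|D|]sum1_card -[#|T|]sum1_card !natr_sum [X in _ + X]big_mkcond -big_split /=.
  by apply: eq_bigr => x _; case: (x \in D); rewrite ?add0r ?addr0.
by rewrite -mulr_sumr mulrC; apply: (canLR (mulfK N_neq0)); rewrite mulrBl mul1r divfK // cD addrK.
Qed.

(** Probability that one draw misses a given point; [al ^+ t] is the probability that all [t] draws
    do. *)
Let al : R := 1 - 1 / N.

Let al_ge0 : 0 <= al.
Proof. by rewrite subr_ge0 ler_pdivrMr // mul1r ler1n. Qed.

Let al_le1 : al <= 1.
Proof. by rewrite gerBl divr_ge0. Qed.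

Let al_lb : 1 - t%:R / N <= al ^+ t.
Proof.
elim: t => [|k IH]; first by rewrite mul0r subr0 expr0.
rewrite exprS -subr_ge0.
have -> : al * al ^+ k - (1 - k.+1%:R / N) =
    al * (al ^+ k - (1 - k%:R / N)) + k%:R / N / N by rewrite /al -natr1; field.
apply: addr_ge0; first by apply: mulr_ge0 => //; rewrite subr_ge0.
by rewrite !mulr_ge0 ?invr_ge0.
Qed.

(** The quadratic term becomes the bound [t^2 / N] on the expected loss through repeated draws. *)
Let al_ub : al ^+ t <= 1 - t%:R / N + (t%:R / N) ^+ 2.
Proof.
elim: t => [|k IH]; first by rewrite mul0r subr0 expr0 expr0n addr0.
rewrite exprS -subr_ge0.
have -> : 1 - k.+1%:R / N + (k.+1%:R / N) ^+ 2 - al * al ^+ k =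
    al * (1 - k%:R / N + (k%:R / N) ^+ 2 - al ^+ k)
    + (k%:R / N / N + 1 / N / N + (k%:R / N) ^+ 2 / N).
  by rewrite /al -natr1; field.
apply: addr_ge0; first by apply: mulr_ge0 => //; rewrite subr_ge0.
by rewrite !addr_ge0 ?mulr_ge0 ?invr_ge0 ?exprn_ge0 ?mulr_ge0 ?invr_ge0.
Qed.

Let missed (x : T) (e : {ffun 'I_t -> T}) : R := \prod_i (e i \notin [set x]%SET)%:R.

Let missed_im (e : {ffun 'I_t -> T}) : #|e @: [set: 'I_t]|%:R = N - \sum_x missed x e.
Proof.
apply/eqP; rewrite eq_sym subr_eq; apply/eqP.
rewrite /N -[#|_ @: _|]sum1_card -[#|T|]sum1_card !natr_sum [X in X + _]big_mkcond -big_split /=.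
apply: eq_bigr => x _; rewrite /missed -natr_prod.
have [/imsetP[i _ ->]|xe] := boolP (x \in _).
  by rewrite (bigD1 i) //= !inE eqxx mul0n addr0.
rewrite big1 ?add0r // => i _; rewrite !inE; case: eqP => // xi.
by rewrite -xi imset_f in xe.
Qed.

Let missed_mean x : \sum_e unif_law e * missed x e = al ^+ t.
Proof. by rewrite unif_avoid cards1. Qed.

(** For distinct points the events of being missed are negatively correlated, since
    [1 - 2 / N <= (1 - 1 / N)^2]. *)
Let missed_pair x y : \sum_e unif_law e * (missed x e * missed y e) <=
  (if x == y then al ^+ t else al ^+ t * al ^+ t).
Proof.
case: eqP => [<-|/eqP xy].
  rewrite -(missed_mean x) le_eqVlt; apply/orP; left; apply/eqP.
  apply: eq_bigr => e _; congr (_ * _); rewrite /missed -big_split /=.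
  by apply: eq_bigr => i _; case: (_ \notin _); rewrite ?mulr1 ?mulr0.
rewrite (eq_bigr (fun e => unif_law e * \prod_i (e i \notin [set x; y]%SET)%:R)); last first.
  move=> e _; rewrite /missed -big_split /=; congr (_ * _); apply: eq_bigr => i _.
  by rewrite !inE negb_or; do 2!case: eqP => _; rewrite /= ?mulr0 ?mul0r ?mulr1.
(* Two distinct points force [2 <= N], which makes the base [1 - 2 / N] nonnegative, as monotonicity
   of powers requires. *)
rewrite unif_avoid cards2 xy -exprMn; have N2 : 2 <= N.
  by rewrite ler_nat -[2%N]/((true).+1) -xy -cards2 max_card.
apply: lerXn2r; rewrite ?nnegrE ?mulr_ge0 //.
  by rewrite subr_ge0 ler_pdivrMr // mul1r.
have -> : al * al = 1 - 2 / N + 1 / N / N by rewrite /al; field.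
by rewrite lerDl !mulr_ge0 ?invr_ge0.
Qed.

(** The image omits exactly the missed points. Their off-diagonal covariances are at most 0, and the
    diagonal gives [N a (1 - a) <= N (1 - a) <= t] with [a = al ^+ t]. *)
Lemma image_card_var : \sum_e unif_law e *
  (#|e @: [set: 'I_t]|%:R - N * (1 - (1 - 1 / N) ^+ t)) ^+ 2 <= t%:R.
Proof.
rewrite -/al; have a0 : 0 <= al ^+ t by rewrite exprn_ge0.
have a1 : al ^+ t <= 1 by rewrite exprn_ile1.
have -> : \sum_e unif_law e * (#|e @: [set: 'I_t]|%:R - N * (1 - al ^+ t)) ^+ 2 =
    \sum_x \sum_y \sum_e unif_law e * ((missed x e - al ^+ t) * (missed y e - al ^+ t)).
  apply/esym; under eq_bigr do rewrite exchange_big /=.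
  rewrite exchange_big /=; apply: eq_bigr => e _.
  under eq_bigr do rewrite -mulr_sumr -mulr_sumr.
  rewrite -mulr_sumr -mulr_suml sumrB sumr_const missed_im -[al ^+ t *+ _]mulr_natl -/N.
  by congr (_ * _); ring.
have cov x y : \sum_e unif_law e * ((missed x e - al ^+ t) * (missed y e - al ^+ t)) <=
    (if x == y then al ^+ t - al ^+ t * al ^+ t else 0).
  have -> : \sum_e unif_law e * ((missed x e - al ^+ t) * (missed y e - al ^+ t)) =
      \sum_e unif_law e * (missed x e * missed y e) - al ^+ t * al ^+ t.
    rewrite (eq_bigr (fun e => unif_law e * (missed x e * missed y e)
      - al ^+ t * (unif_law e * missed x e) - al ^+ t * (unif_law e * missed y e)
      + al ^+ t * al ^+ t * unif_law e)); last by move=> e _; ring.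
    rewrite big_split /= !sumrB -[X in _ - X - _]mulr_sumr.
    rewrite -[X in _ - _ - X + _]mulr_sumr -[X in _ + X = _]mulr_sumr.
    by rewrite !missed_mean unif_law_sum1; ring.
  by have := missed_pair x y; case: ifP => _; lra.
apply: (@le_trans _ _ (\sum_(x : T) (al ^+ t - al ^+ t * al ^+ t))).
  apply: ler_sum => x _; apply: le_trans (ler_sum _ (fun y _ => cov x y)) _.
  by rewrite -big_mkcond (big_pred1 x) // => y; rewrite eq_sym.
rewrite sumr_const -[leLHS]mulr_natl -/N -[leRHS](mulfVK N_neq0) mulrC.
apply: ler_wpM2r; first exact: ltW.
by have := al_lb; nra.
Qed.

Lemma image_card_mean_ge : t%:R - t%:R ^+ 2 / N <= N * (1 - (1 - 1 / N) ^+ t).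
Proof.
have -> : t%:R - t%:R ^+ 2 / N = N * (1 - (1 - t%:R / N + (t%:R / N) ^+ 2)).
  by field.
by rewrite ler_pM2l // lerB // al_ub.
Qed.

(** A uniform permutation of [T] preserves both laws, so only cardinalities need comparing. The
    slack [2 * d] allows a deviation [d] to each of the two random sets. The alternative [q = 0]
    serves probabilities clamped to 0. *)
Lemma bernoulli_le_unif (q d : R) (G : {set T} -> R) : 0 <= q <= 1 -> 0 < d ->
  q = 0 \/ N * q + 2 * d <= t%:R - t%:R ^+ 2 / N ->
  {homo G : B C / B \subset C >-> B <= C} -> (forall B, 0 <= G B <= 1) ->
  \sum_B bernoulli_law (fun=> q) B * G B <=
  \sum_e unif_law e * G (e @: [set: 'I_t]) + 2 * t%:R / d ^+ 2.
Proof.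
move=> /andP[q0 q1] d0 qt Gmono G01.
have b0 (B : {set T}) : 0 <= bernoulli_law (fun=> q) B by apply: bernoulli_law_ge0 => _; rewrite q0.
pose good (B : {set T}) (e : {ffun 'I_t -> T}) := (#|B| <= #|e @: [set: 'I_t]|)%N.
have main : \sum_B bernoulli_law (fun=> q) B * G B <=
    \sum_e unif_law e * G (e @: [set: 'I_t]) +
    \sum_B \sum_(e | ~~ good B e) bernoulli_law (fun=> q) B * unif_law e.
  apply: (@symmetric_coupling R {perm T} _ _ _ _ b0 unif_law_ge0
    (bernoulli_law_sum1 _) unif_law_sum1
    (fun s B e => G (s @^-1: B)) (fun s e => G (s @^-1: (e @: [set: 'I_t]))) _ _ good).
  - by apply/card_gt0P; exists 1%g.
  - by move=> s B _; case/andP: (G01 (s @^-1: B)).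
  - by move=> s e; case/andP: (G01 (s @^-1: (e @: [set: 'I_t]))).
  - by move=> s _; apply: sum_bernoulli_preim => //; exact: perm_inj.
  - move=> s; rewrite -(@sum_unif_inj (fun=> s) (fun e => G (s @^-1: (e @: _)))); last first.
      by move=> _; exact: perm_inj.
    apply: eq_bigr => e _; congr (_ * G _); apply/setP => x; rewrite inE.
    apply/imsetP/imsetP => -[i _ xi]; exists i => //; last by rewrite ffunE xi.
    by apply: (@perm_inj _ s); rewrite xi ffunE.
  - (* If #|B| <= #|im e|, some permutation of T carries B into the image of e. *)
    move=> B e /perm_preimset_sub[s0 s0B]; rewrite (reindex_inj (mulIg s0)) /=.
    apply: ler_sum => s _; apply: Gmono.
    have -> : (s * s0)%g @^-1: B = s @^-1: (s0 @^-1: B).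
      by apply/setP => x; rewrite !inE permM.
    exact: preimsetS.
apply: le_trans main _; rewrite lerD2l.
(* For [q = 0] the binomial set is almost surely empty, and no pair with [B] empty is bad. *)
case: qt => [q_eq0|qt].
  rewrite big1 ?divr_ge0 ?mulr_ge0 ?exprn_ge0 ?(ltW d0) // => B _; apply: big1 => e.
  rewrite /good; have [->|[x xB]] := set_0Vmem B; first by rewrite cards0.
  by move=> _; rewrite /bernoulli_law (bigD1 x) //= xB q_eq0 !mul0r.
(* If neither [P] nor [Q] holds, then [#|B| < N q + d <= t - t^2 / N - d <= mn - d], which is less
   than the size of the image, so the pair is good. *)
pose P (B : {set T}) := N * q + d <= #|B|%:R.
pose mn := N * (1 - (1 - 1 / N) ^+ t).
pose Q (e : {ffun 'I_t -> T}) := #|e @: [set: 'I_t]|%:R <= mn - d.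
apply: le_trans (union_bound2 b0 unif_law_ge0 (bernoulli_law_sum1 _) unif_law_sum1
  (P := P) (Q := Q) _) _.
  move=> B e; rewrite -ltnNge -(ltr_nat R) /P /Q => lt.
  rewrite -implyNb; apply/implyP; rewrite -ltNge => HB.
  have := image_card_mean_ge; rewrite -/mn; move: lt HB qt.
  move: (#|e @: _|%:R : R) (#|B|%:R : R) => u v; lra.
have PB : \sum_(B | P B) bernoulli_law (fun=> q) B <= (N * q) / d ^+ 2.
  apply: le_trans (markov_sqr b0 (f := fun B => #|B|%:R) (c := \sum_(x : T) q) d0 _) _.
    move=> B; rewrite /P sumr_const -[q *+ _]mulr_natl -/N => HB.
    by rewrite ler_normr; apply/orP; left; rewrite lerBrDl.
  rewrite bernoulli_card_var sumr_const -[_ *+ _]mulr_natl -/N.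
  rewrite ler_wpM2r ?invr_ge0 ?exprn_ge0 ?(ltW d0) // ler_wpM2l //.
  by rewrite -[leRHS]mulr1 ler_wpM2l // gerBl.
have Qe : \sum_(e | Q e) unif_law e <= t%:R / d ^+ 2.
  apply: le_trans (markov_sqr unif_law_ge0 (f := fun e => #|e @: [set: 'I_t]|%:R)
    (c := mn) d0 _) _.
    by move=> e; rewrite /Q ler_normr => He; apply/orP; right; rewrite opprB lerBrDl -lerBrDr.
  by rewrite ler_wpM2r ?image_card_var // invr_ge0 exprn_ge0 ?(ltW d0).
apply: le_trans (lerD PB Qe) _; rewrite -mulrDl ler_wpM2r ?invr_ge0 ?exprn_ge0 ?(ltW d0) //.
(* Hence [N q <= t], and each of the two tails is at most [t / d^2]. *)
have : 0 <= t%:R ^+ 2 / N by rewrite mulr_ge0 ?invr_ge0 ?exprn_ge0.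
lra.
Qed.

End WithReplacement.

(** * Cliques in random intersection graphs *)

Section Graphs.
Variable V : finType.

(** Vertices sharing a feature form a clique, which contains every pair inside such a hyperedge. *)
Lemma shadowU_sub (H K : {set {set V}}) (F : finType) (W : V -> {set F}) :
  (forall h, h \in H :|: K -> exists w, forall v, v \in h -> w \in W v) ->
  edges (sgraphU (shadow H) (shadow K)) \subset edges (intersection_graph W).
Proof.
move=> HW.
have sub (L : {set {set V}}) : L \subset H :|: K ->
    edges (shadow L) \subset edges (intersection_graph W).
  move=> LHK; apply/fintype.subsetP => e /imset2P[x y _].
  rewrite inE /= => /andP[_ /andP[xy /exists_inP[h /(fintype.subsetP LHK) /HW[w wh] xyh]]] ->.
  apply/imset2P; exists x y => //; rewrite !inE /= xy /=.
  apply/set0Pn; exists w; rewrite inE.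
  by rewrite !wh // (fintype.subsetP xyh) // !inE eqxx ?orbT.
by rewrite finset.subUset !sub // (finset.subsetUl, finset.subsetUr).
Qed.

Lemma shadow_mono (H K : {set {set V}}) : H \subset K ->
  edges (shadow H) \subset edges (shadow K).
Proof.
move=> HK; apply/fintype.subsetP => e /imset2P[x y _].
rewrite inE /= => /andP[_ /andP[xy /exists_inP[h hH xyh]]] ->.
apply/imset2P; exists x y => //; rewrite !inE /= xy /=.
by apply/exists_inP; exists h => //; exact: (fintype.subsetP HK).
Qed.

Lemma shadow0 : edges (shadow (finset.set0 : {set {set V}})) = finset.set0.
Proof.
apply/setP => e; rewrite inE; apply/negP => /imset2P[x y _].
by rewrite inE /= => /andP[_ /andP[_ /exists_inP[h]]]; rewrite inE.
Qed.

(** A separate type, so that hyperedges can be drawn uniformly and a binomial hypergraph becomes a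
    random set with constant parameter. *)
Definition kset (k : nat) := {e : {set V} | #|e| == k}.

Lemma card_kset (k : nat) : #|{: kset k}| = 'C(#|V|, k).
Proof.
by rewrite card_sig -(card_draws V k); apply: eq_card => e; rewrite !inE.
Qed.

Lemma kset_preim_subproof (k : nat) (s : {perm V}) (e : kset k) : #|s @^-1: val e| == k.
Proof. by rewrite card_preimset ?(valP e) //; exact: perm_inj. Qed.

Definition kset_preim (k : nat) (s : {perm V}) (e : kset k) : kset k :=
  Sub (s @^-1: val e) (kset_preim_subproof s e).

Lemma kset_preim_inj k s : injective (@kset_preim k s).
Proof.
by move=> e f /(congr1 val) /(preimset_injective (@perm_inj _ s)) ef; apply: val_inj.
Qed.

(** Each [w] offers [c w] slots, collected in a tagged sum; the first [t] slots define [f]. *)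
Lemma bounded_assignment (F : finType) (t : nat) (c : F -> nat) : (t <= \sum_w c w)%N ->
  exists f : 'I_t -> F, forall w, (#|[set j | f j == w]%SET| <= c w)%N.
Proof.
move=> tc; have ct : #|{: {w : F & 'I_(c w)}}| = (\sum_w c w)%N.
  rewrite card_tagged sumnE big_map big_enum /=.
  by apply: eq_bigr => w _; rewrite card_ord.
rewrite -ct in tc; pose f (j : 'I_t) := enum_val (widen_ord tc j).
exists (fun j => tag (f j)) => w.
have f_inj : injective f by move=> i j /enum_val_inj [ij]; apply: val_inj.
have Tw : injective (fun i : 'I_(c w) => Tagged (fun w => 'I_(c w)) i).
  by move=> i j /eqP; rewrite eq_Tagged /= => /eqP.
rewrite -(card_imset _ f_inj) -[leqRHS]card_ord -(card_imset _ Tw).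
apply/subset_leq_card/fintype.subsetP => y /imsetP[j]; rewrite inE => /eqP jw {y}->.
apply/imsetP; case: (f j) jw => w' i /= ww'; rewrite ww' in i *; by exists i.
Qed.

End Graphs.

(** Points outside [a] are almost surely absent. This moves [hypergraph_law] from all vertex sets to
    [kset]. *)
Lemma sum_bernoulli_sub (R : realType) (T : finType) (a : pred T) (q : R)
    (h : {set T} -> R) :
  \sum_B bernoulli_law (fun x => if a x then q else 0) B * h B =
  \sum_(B : {set {x : T | a x}}) bernoulli_law (fun=> q) B * h (val @: B).
Proof.
pose a' := [set x | a x]%SET.
rewrite (bigID (fun B : {set T} => B \subset a')) /= [X in _ + X]big1 ?addr0; last first.
  move=> B /subsetPn[x xB]; rewrite inE => /negbTE ax.
  by rewrite /bernoulli_law (bigD1 x) //= xB ax !mul0r.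
rewrite (reindex_onto (fun B : {set {x | a x}} => val @: B) (fun B => val @^-1: B)) /=; last first.
  move=> B /fintype.subsetP Ba; apply/setP => x; apply/imsetP/idP => [[y]|xB].
    by rewrite inE => yB ->.
  have ax : a x by have := Ba _ xB; rewrite inE.
  by exists (Sub x ax); rewrite ?inE SubK.
apply: eq_big => [B|B _].
  apply/andP; split.
    by apply/fintype.subsetP => _ /imsetP[x _ ->]; rewrite inE (valP x).
  by apply/eqP/setP => x; rewrite inE (mem_imset _ _ val_inj).
congr (_ * _); rewrite /bernoulli_law (bigID (mem a')) /= [X in _ * X]big1 ?mulr1; last first.
  move=> x; rewrite inE => ax; rewrite (negbTE ax) ifF ?subr0 //.
  by apply/negP => /imsetP[y _ xy]; rewrite xy (valP y) in ax.
rewrite (eq_bigl (fun x => x \in [pred x | a x])); last by move=> x; rewrite !inE.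
rewrite big_sub; apply: eq_bigr => x _.
have ax : a (\val x) := valP x.
by rewrite (mem_imset _ _ val_inj) ax.
Qed.

(** * The intersection graph dominates sampled pairs and triples *)

Section IntersectionGraphCoupling.
Variables (R : realType) (V F : finType) (p : F -> R) (A : {set sgraph V}).
Hypotheses (p01 : forall w, 0 <= p w <= 1) (A_incr : increasing A).

Let law (B : {set V * F}) : R := bernoulli_law (fun vw : V * F => p vw.2) B.

Definition rig (B : {set V * F}) : sgraph V :=
  intersection_graph (fun v => [set w | (v, w) \in B]%SET).

Definition holders (B : {set V * F}) (w : F) : {set V} := [set v | (v, w) \in B]%SET.

Definition sampled_graph (t2 t3 : nat) (e2 : {ffun 'I_t2 -> kset V 2})
    (e3 : {ffun 'I_t3 -> kset V 3}) : sgraph V :=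
  sgraphU (shadow (val @: (e2 @: [set: 'I_t2]))) (shadow (val @: (e3 @: [set: 'I_t3]))).

Let shuffle (s : {ffun F -> {perm V}}) (x : V * F) : V * F := (s x.2 x.1, x.2).

Let shuffle_inj s : injective (shuffle s).
Proof. by move=> [v w] [v' w'] [] /[swap] <- /perm_inj ->. Qed.

(** Draw [j] follows the permutation of the feature [f j] that is to absorb it. *)
Let shuffled (t k : nat) (s : {ffun F -> {perm V}}) (f : 'I_t -> F)
  (e : {ffun 'I_t -> kset V k}) := [ffun j => kset_preim (s (f j)) (e j)].

Let sum_shuffled (t k : nat) s (f : 'I_t -> F) (h : {ffun 'I_t -> kset V k} -> R) :
  \sum_e unif_law R e * h (shuffled s f e) = \sum_e unif_law R e * h e.
Proof.
apply: (@sum_unif_inj _ _ _ (fun j => kset_preim (s (f j)))) => j.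
exact: kset_preim_inj.
Qed.

(* A feature held by at least 2 i + 3 j vertices can absorb i pairs and j triples:
   permuting the vertices independently for each feature preserves both laws, and
   moves the union of these pairs and triples into the set of holders. *)
Lemma rig_ge_sampled (c2 c3 : nat -> nat) (t2 t3 : nat) : (0 < #|F|)%N ->
  (0 < #|{: kset V 2}|)%N -> (0 < #|{: kset V 3}|)%N ->
  (forall k, 2 * c2 k + 3 * c3 k <= k)%N ->
  \sum_e2 unif_law R e2 * \sum_e3 unif_law R e3 * (@sampled_graph t2 t3 e2 e3 \in A)%:R <=
  \sum_(B | rig B \in A) law B +
  \sum_(B | ~~ ((t2 <= \sum_w c2 #|holders B w|) && (t3 <= \sum_w c3 #|holders B w|))%N) law B.
Proof.
move=> F0 K2 K3 c23.
have law0 B : 0 <= law B by apply: bernoulli_law_ge0.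
pose X := ({ffun 'I_t2 -> kset V 2} * {ffun 'I_t3 -> kset V 3})%type.
pose mu (x : X) := unif_law R x.1 * unif_law R x.2.
have mu0 x : 0 <= mu x by rewrite mulr_ge0 ?unif_law_ge0.
have mu1 : \sum_x mu x = 1.
  rewrite -(pair_bigA _ (fun e2 e3 => unif_law R e2 * unif_law R e3)) /=.
  by under eq_bigr do rewrite -mulr_sumr unif_law_sum1 // mulr1; rewrite unif_law_sum1.
pose good B := ((t2 <= \sum_w c2 #|holders B w|) && (t3 <= \sum_w c3 #|holders B w|))%N.
(* The assignment of draws to features depends on [B] alone, which the coupling allows. For bad [B]
   a constant map serves as default. *)
have /choice[asg asgP] : forall B, exists f : ('I_t2 -> F) * ('I_t3 -> F), good B ->
    forall w, ((#|[set j | f.1 j == w]%SET| <= c2 #|holders B w|)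
      && (#|[set j | f.2 j == w]%SET| <= c3 #|holders B w|))%N.
  move=> B; have [/andP[/bounded_assignment[f2 f2P] /bounded_assignment[f3 f3P]]|_] :=
    boolP (good B); first by exists (f2, f3) => _ w; rewrite f2P f3P.
  by have [w _] := card_gt0P F0; exists (fun=> w, fun=> w).
have sumA (P : pred {set V * F}) : \sum_(B | P B) law B = \sum_B law B * (P B)%:R.
  by rewrite big_mkcond; apply: eq_bigr => B _; case: (P B); rewrite ?mulr1 ?mulr0.
rewrite (sumA (fun B => rig B \in A)).
have -> : \sum_(B | ~~ good B) law B = \sum_x \sum_(B | ~~ good B) mu x * law B.
  by under [RHS]eq_bigr do rewrite -mulr_sumr; rewrite -mulr_suml mu1 mul1r.
apply: (@symmetric_coupling R {ffun F -> {perm V}} X _ mu law mu0 law0 mu1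
  (bernoulli_law_sum1 _)
  (fun s x B => (sampled_graph (shuffled s (asg B).1 x.1) (shuffled s (asg B).2 x.2) \in A)%:R)
  (fun s B => (rig (shuffle s @^-1: B) \in A)%:R) _ _ (fun _ B => good B)).
- by apply/card_gt0P; exists [ffun=> 1%g].
- by move=> s x B; rewrite lern1 leq_b1.
- by [].
- move=> s B; rewrite -(pair_bigA _ (fun e2 e3 => unif_law R e2 * unif_law R e3 *
    (sampled_graph (shuffled s (asg B).1 e2) (shuffled s (asg B).2 e3) \in A)%:R)) /=.
  rewrite -(sum_shuffled s (asg B).1); apply: eq_bigr => e2 _.
  under eq_bigr do rewrite -mulrA.
  rewrite -mulr_sumr; congr (_ * _).
  exact: (sum_shuffled s (asg B).2
    (fun e3 => (sampled_graph (shuffled s (asg B).1 e2) e3 \in A)%:R)).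
- by move=> s; apply: sum_bernoulli_preim; first exact: shuffle_inj.
move=> [e2 e3] B /asgP/=; move: (asg B) => [f2 f3] /= fP.
(* The vertices covered by the draws assigned to [w]: no more than the holders of [w], by [c23]. *)
pose U w := (\bigcup_(j in [set j | f2 j == w]%SET) val (e2 j))
         :|: (\bigcup_(j in [set j | f3 j == w]%SET) val (e3 j)).
have card_bigcup (I : finType) (D : {set I}) (E : I -> {set V}) (k : nat) :
    (forall i, #|E i| = k) -> (#|\bigcup_(i in D) E i| <= k * #|D|)%N.
  move=> Ek; rewrite -[X in (_ * X)%N]sum1_card big_distrr /=.
  elim/big_ind2: _ => [|m C n D' Cm Dn|i _]; rewrite ?cards0 ?muln1 ?Ek //.
  by apply: leq_trans (leq_card_setU _ _) (leq_add _ _).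
have /choice[tau tauP] w : exists s : {perm V}, s @^-1: U w \subset holders B w.
  apply: perm_preimset_sub; apply: leq_trans (leq_card_setU _ _) _.
  apply: leq_trans (c23 _); have /andP[h2 h3] := fP w.
  apply: leq_add; apply: (leq_trans (card_bigcup _ _ _ _ _)) => [j|].
  - exact/eqP/(valP (e2 j)).
  - by rewrite leq_mul2l h2 orbT.
  - exact/eqP/(valP (e3 j)).
  - by rewrite leq_mul2l h3 orbT.
(* Composing each [s w] with [tau w] only reorders the sum over [s]; afterwards the moved draws lie
   in the moved holder sets for every [s], and the sums compare termwise. *)
have tau_inj : injective (fun s : {ffun F -> {perm V}} => [ffun w => (s w * tau w)%g]).
  by move=> s s' /ffunP ss'; apply/ffunP => w; have := ss' w; rewrite !ffunE => /mulIg.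
rewrite (reindex_inj tau_inj) /=; apply: ler_sum => s _.
rewrite ler_nat; case: (boolP (_ \in A)) => //= inA; rewrite lt0b.
apply: A_incr inA; apply: shadowU_sub => h.
rewrite inE => /orP[] /imsetP[_ /imsetP[j _ ->] ->]; rewrite ffunE /=.
- exists (f2 j) => v; rewrite !inE ffunE permM => ve.
  have := fintype.subsetP (tauP (f2 j)) (s (f2 j) v); rewrite !inE; apply.
  by apply/orP; left; apply/bigcupP; exists j; rewrite ?inE.
- exists (f3 j) => v; rewrite !inE ffunE permM => ve.
  have := fintype.subsetP (tauP (f3 j)) (s (f3 j) v); rewrite !inE; apply.
  by apply/orP; right; apply/bigcupP; exists j; rewrite ?inE.
Qed.

End IntersectionGraphCoupling.

(** * Moments of the clique sizes *)

Section BinomialMoments.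
Variables (R : realType) (V : finType) (p : R).
Hypothesis p01 : 0 <= p <= 1.
Let n := #|V|.

(** Mean of [f X] for [X] binomial with parameters [n] and [p], realized as the size of a random
    subset of [V]. *)
Definition binom_mean (f : nat -> R) : R :=
  \sum_(B : {set V}) bernoulli_law (fun=> p) B * f #|B|.

Let law_ge0 (B : {set V}) : 0 <= bernoulli_law (fun=> p) B.
Proof. exact: bernoulli_law_ge0. Qed.

Lemma eq_binom_mean f g : f =1 g -> binom_mean f = binom_mean g.
Proof. by move=> fg; apply: eq_bigr => B _; rewrite fg. Qed.

Lemma binom_meanD f g : binom_mean (fun k => f k + g k) = binom_mean f + binom_mean g.
Proof. by rewrite -big_split; apply: eq_bigr => B _; rewrite mulrDr. Qed.

Lemma binom_meanZ c f : binom_mean (fun k => c * f k) = c * binom_mean f.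
Proof. by rewrite mulr_sumr; apply: eq_bigr => B _; rewrite mulrCA. Qed.

Lemma binom_mean_cst c : binom_mean (fun=> c) = c.
Proof. by rewrite /binom_mean -mulr_suml bernoulli_law_sum1 mul1r. Qed.

Lemma le_binom_mean f g : (forall k, f k <= g k) -> binom_mean f <= binom_mean g.
Proof. by move=> fg; apply: ler_sum => B _; rewrite ler_wpM2l. Qed.

Lemma binom_mean_id : binom_mean (fun k => k%:R) = n%:R * p.
Proof.
rewrite /binom_mean (sum_bernoulli_prod_law (fun=> p) (fun B : {set V} => #|B|%:R)).
pose mu (x : V) (b : bool) := if b then p else 1 - p.
have mu1 x : \sum_b mu x b = 1 by rewrite big_bool /= addrC subrK.
transitivity (\sum_x \sum_g prod_law mu g * (g x : bool)%:R).
  rewrite exchange_big /=; apply: eq_bigr => g _; rewrite -mulr_sumr; congr (_ * _).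
  by rewrite -sum1_card natr_sum big_mkcond; apply: eq_bigr => x _; rewrite inE; case: (g x).
under eq_bigr => x _.
  rewrite (prod_law1 mu1 x (fun b : bool => b%:R)) big_bool /= mulr1 mulr0 addr0.
  over.
by rewrite sumr_const mulr_natl.
Qed.

Lemma binom_mean_var : binom_mean (fun k => (k%:R - n%:R * p) ^+ 2) = n%:R * p * (1 - p).
Proof.
have := bernoulli_card_var (fun _ : V => p).
have sumc (c : R) : \sum_(x : V) c = n%:R * c by rewrite sumr_const mulr_natl.
by rewrite !sumc mulrA.
Qed.

Lemma binom_mean_eq1 : binom_mean (fun k => (k == 1%N)%:R) = n%:R * p * (1 - p) ^+ n.-1.
Proof.
transitivity (\sum_(x : V) bernoulli_law (fun=> p) [set x]%SET).
  rewrite /binom_mean (bigID (fun B : {set V} => #|B| == 1%N)) /=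
    [X in _ + X]big1 ?addr0; last first.
    by move=> B /negbTE ->; rewrite mulr0.
  rewrite (eq_bigr (fun B => bernoulli_law (fun=> p) B)); last by move=> B ->; rewrite mulr1.
  rewrite -(big_imset _ (in2W (@finset.set1_inj V))) /=; apply: eq_bigl => B.
  apply/cards1P/imsetP => [[x ->]|[x _ ->]]; by exists x.
rewrite -mulrA mulr_natl -sumr_const; apply: eq_bigr => x _.
rewrite /bernoulli_law (bigD1 x) //= inE eqxx; congr (_ * _).
rewrite (eq_bigr (fun=> 1 - p)); last by move=> y /negbTE yx; rewrite inE yx.
by rewrite prodr_const; congr (_ ^+ _); rewrite cardC1.
Qed.

(** The sign is a product over independent bits, each factor of mean [1 - 2 p]. The parity of [X],
    hence the power in [S2] and [S3], is computed from it. *)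
Lemma binom_mean_sign : binom_mean (fun k => (-1) ^+ k) = (1 - 2 * p) ^+ n.
Proof.
rewrite /binom_mean (sum_bernoulli_prod_law (fun=> p) (fun B : {set V} => (-1) ^+ #|B|)).
rewrite (eq_bigr (fun g : {ffun V -> bool} =>
    prod_law (fun _ (b : bool) => if b then p else 1 - p) g * \prod_x (-1) ^+ g x)).
  rewrite (prod_law_prod _ (fun (x : V) (b : bool) => (-1) ^+ b)) prodr_const big_bool /=.
  by congr (_ ^+ _); rewrite expr1 expr0; ring.
move=> g _; congr (_ * _); rewrite -prodr_const big_mkcond /=.
by apply: eq_bigr => x _; rewrite inE; case: (g x).
Qed.

(* cl_size X = X 1_{X >= 2} and cl_odd X = 1_{X >= 3 odd}; for X ~ Bin(n, p) their
   means are the summands of S1 and S3. *)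
Definition cl_size (k : nat) : R := k%:R - (k == 1%N)%:R.
Definition cl_odd (k : nat) : R := (odd k)%:R - (k == 1%N)%:R.

Lemma binom_mean_cl_size : binom_mean cl_size = n%:R * p * (1 - (1 - p) ^+ n.-1).
Proof.
rewrite (@eq_binom_mean _ (fun k => k%:R + (-1) * (k == 1%N)%:R)); last by move=> k; rewrite mulN1r.
by rewrite binom_meanD binom_meanZ binom_mean_id binom_mean_eq1; ring.
Qed.

Lemma binom_mean_cl_odd :
  binom_mean cl_odd = (1 - (1 - 2 * p) ^+ n) / 2 - n%:R * p * (1 - p) ^+ n.-1.
Proof.
rewrite (@eq_binom_mean _ (fun k => 1 / 2 + ((- 1 / 2) * (-1) ^+ k + (-1) * (k == 1%N)%:R))).
  by rewrite !binom_meanD !binom_meanZ binom_mean_cst binom_mean_sign binom_mean_eq1; field.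
by move=> k; rewrite /cl_odd -signr_odd; case: (odd k); rewrite /= ?expr1 ?expr0; field.
Qed.

Lemma cl_odd_bool k : cl_odd k = (odd k && (k != 1%N))%:R.
Proof. by rewrite /cl_odd; case: eqP => [->|_]; rewrite ?andbT ?subr0 // subrr. Qed.

Lemma cl_odd_le k : 3 * cl_odd k <= cl_size k.
Proof.
rewrite cl_odd_bool /cl_size; case: k => [|[|[|k]]]; rewrite /= ?subrr ?subr0 ?mulr0 //.
by case: (~~ ~~ odd k); rewrite /= ?mulr0 ?mulr1 // ler_nat.
Qed.

Lemma binom_mean_cl_odd_ge0 : 0 <= binom_mean cl_odd.
Proof. by rewrite -(binom_mean_cst 0); apply: le_binom_mean => k; rewrite cl_odd_bool. Qed.

Lemma binom_mean_cl_odd_le : 3 * binom_mean cl_odd <= binom_mean cl_size.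
Proof. by rewrite -binom_meanZ; apply: le_binom_mean => k; exact: cl_odd_le. Qed.

Definition binom_var (f : nat -> R) : R := binom_mean (fun k => (f k - binom_mean f) ^+ 2).

Lemma binom_var_cl_odd : binom_var cl_odd <= binom_mean cl_odd.
Proof.
have := variance_le (fun B : {set V} => cl_odd #|B|) (bernoulli_law_sum1 (fun=> p)).
rewrite -[X in X <= _]/(binom_var cl_odd) => h; apply: (le_trans h).
apply: ler_sum => B _; apply: ler_wpM2l => //.
by rewrite cl_odd_bool; case: (_ && _); rewrite ?expr1n ?expr0n.
Qed.

(** The right side is the sum of [p (1 - p)^j] over [j < k], with every term at least
    [p (1 - p)^k]. *)
Let pow_bound (k : nat) : k%:R * p * (1 - p) ^+ k <= 1 - (1 - p) ^+ k.
Proof.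
have /andP[p0 p1] := p01; have q0 : 0 <= 1 - p by rewrite subr_ge0.
elim: k => [|k IH]; first by rewrite !mul0r expr0 subrr.
have : (1 - p) ^+ k.+1 = (1 - p) ^+ k - p * (1 - p) ^+ k by rewrite exprS; ring.
have : 0 <= (1 - p) ^+ k by apply: exprn_ge0.
have : 0 <= k%:R :> R by [].
move: IH; set u := (1 - p) ^+ k; set K := k%:R => IH K0 u0 ->.
have : 0 <= (K + 1) * p ^+ 2 * u by rewrite mulr_ge0 // mulr_ge0 ?sqr_ge0 // addr_ge0.
have -> : k.+1%:R * p * (u - p * u) = K * p * u + p * u - (K + 1) * p ^+ 2 * u.
  by rewrite /K -natr1; ring.
by lra.
Qed.

(** The variance is at most [a (1 - u) + 2 a (a u)], where [a (1 - u)] is the mean, and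
    [a u <= 2 (1 - u)] bounds the second term by four times the mean. *)
Lemma binom_var_cl_size : (1 < n)%N -> binom_var cl_size <= 5 * binom_mean cl_size.
Proof.
move=> n1; rewrite /binom_var; set c := binom_mean cl_size; set a := n%:R * p.
set u := (1 - p) ^+ n.-1.
have cE : c = a * (1 - u) by rewrite /c binom_mean_cl_size.
rewrite (@eq_binom_mean _ (fun k => (k%:R - a) ^+ 2 + ((2 * a - 2 * c) * k%:R +
    ((2 * c - 1) * (k == 1%N)%:R + (c ^+ 2 - a ^+ 2))))); last first.
  by move=> k; rewrite /cl_size; case: eqP => [->|_]; rewrite ?mulr1n ?mulr0n; ring.
rewrite !binom_meanD 2!binom_meanZ !binom_mean_cst binom_mean_var
  binom_mean_id binom_mean_eq1 -/a -/u cE.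
have /andP[p0 p1] := p01.
have u0 : 0 <= u by rewrite exprn_ge0 ?subr_ge0.
have u1 : u <= 1 by rewrite exprn_ile1 ?subr_ge0 // gerBl.
have a0 : 0 <= a by rewrite mulr_ge0.
(* [pow_bound] at exponent [n - 1]; the factor 2 comes from [n <= 2 (n - 1)]. *)
have au : a * u <= 2 * (1 - u).
  have := pow_bound n.-1; rewrite -/u => h; apply: le_trans (ler_wpM2l _ h) => //.
  rewrite !mulrA ler_wpM2r // ler_wpM2r // -natrM ler_nat; lia.
have : 0 <= a * p by rewrite mulr_ge0.
have : 0 <= a ^+ 2 * u ^+ 2 by apply: mulr_ge0; exact: sqr_ge0.
have := ler_wpM2l a0 au.
move=> h1 h2 h3.
rewrite [leLHS](_ : _ = a * (1 - u) - a * p + 2 * (a * (a * u)) - a ^+ 2 * u ^+ 2); last by ring.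
by lra.
Qed.

End BinomialMoments.

(** * Comparison for a fixed number of vertices *)

Section HoldersLaw.
Variables (R : realType) (V F : finType) (p : F -> R).
Hypothesis p01 : forall w, 0 <= p w <= 1.

(** Reading [B] feature by feature shows that the holder sets of distinct features are
    independent. *)
Lemma sum_holders (h : {ffun F -> {set V}} -> R) :
  \sum_B bernoulli_law (fun vw : V * F => p vw.2) B * h [ffun w => holders B w] =
  \sum_g prod_law (fun w (D : {set V}) => bernoulli_law (fun=> p w) D) g * h g.
Proof.
rewrite (reindex (fun g : {ffun F -> {set V}} => [set vw | vw.1 \in g vw.2]%SET)) /=.
  apply: eq_bigr => g _; congr (_ * h _).
    transitivity (\prod_v \prod_w (if v \in g w then p w else 1 - p w)).
      by rewrite pair_bigA; apply: eq_bigr => -[v w] _; rewrite inE.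
    by rewrite exchange_big.
  by apply/ffunP => w; rewrite ffunE; apply/setP => v; rewrite !inE.
exists (fun B => [ffun w => holders B w]) => [g _|B _].
- by apply/ffunP => w; rewrite ffunE; apply/setP => v; rewrite !inE.
- by apply/setP => -[v w]; rewrite inE ffunE inE.
Qed.

Lemma holders_tail (f : nat -> R) (P : pred {set V * F}) (d : R) : 0 < d ->
  (forall B, P B -> d <= `|\sum_w f #|holders B w| - \sum_w binom_mean V (p w) f|) ->
  \sum_(B | P B) bernoulli_law (fun vw : V * F => p vw.2) B <=
  (\sum_w binom_var V (p w) f) / d ^+ 2.
Proof.
move=> d0 Pd; have law0 B : 0 <= bernoulli_law (fun vw : V * F => p vw.2) B.
  exact: bernoulli_law_ge0.
apply: le_trans (markov_sqr law0 (f := fun B => \sum_w f #|holders B w|) d0 Pd) _.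
rewrite ler_wpM2r ?invr_ge0 ?exprn_ge0 ?(ltW d0) // le_eqVlt; apply/orP; left; apply/eqP.
have := sum_holders (fun g => (\sum_w f #|g w| - \sum_w binom_mean V (p w) f) ^+ 2).
under eq_bigr do under [\sum_w f _]eq_bigr do rewrite ffunE.
move=> ->; exact: (prod_law_var (fun w => bernoulli_law_sum1 (fun=> p w)) (fun _ D => f #|D|)).
Qed.

End HoldersLaw.

(** * From binomial hypergraphs to the intersection graph *)

Section FiniteComparison.
Variables (R : realType) (n m : nat) (p : 'I_m -> R) (A : {set sgraph 'I_n}).
Hypotheses (n_ge3 : (3 <= n)%N) (m_gt0 : (0 < m)%N).
Hypotheses (p01 : forall w, 0 <= p w <= 1) (A_incr : increasing A).

Let inA (B2 : {set kset 'I_n 2}) (B3 : {set kset 'I_n 3}) : R :=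
  (sgraphU (shadow (val @: B2)) (shadow (val @: B3)) \in A)%:R.

Let inA_mono (B2 B2' : {set kset 'I_n 2}) (B3 B3' : {set kset 'I_n 3}) :
   B2 \subset B2' -> B3 \subset B3' -> inA B2 B3 <= inA B2' B3'.
Proof.
move=> B22 B33; rewrite ler_nat; case: (boolP (_ \in A)) => //= BA; rewrite lt0b.
by apply: A_incr BA; apply: finset.setUSS; apply: shadow_mono; exact: imsetS.
Qed.

Let inA01 B2 B3 : 0 <= inA B2 B3 <= 1.
Proof. by rewrite ler0n lern1 leq_b1. Qed.

Let Pr_G2UG3E q2 q3 : Pr_G2UG3 q2 q3 A =
  \sum_B2 bernoulli_law (fun=> q2) B2 * \sum_B3 bernoulli_law (fun=> q3) B3 * inA B2 B3.
Proof.
rewrite /Pr_G2UG3 big_mkcond /= -(pair_bigA _ (fun H K =>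
  if sgraphU (shadow H) (shadow K) \in A then hypergraph_law 2 q2 H * hypergraph_law 3 q3 K
  else 0)) /=.
transitivity (\sum_H hypergraph_law 2 q2 H * \sum_K hypergraph_law 3 q3 K *
    (sgraphU (shadow H) (shadow K) \in A)%:R).
  apply: eq_bigr => H _; rewrite mulr_sumr; apply: eq_bigr => K _.
  by case: ifP => _; rewrite ?mulr1 // !mulr0.
rewrite (sum_bernoulli_sub (fun e : {set 'I_n} => #|e| == 2) q2); apply: eq_bigr => B2 _.
by rewrite (sum_bernoulli_sub (fun e : {set 'I_n} => #|e| == 3) q3).
Qed.

(** The triples are replaced first, for each fixed set of pairs, then the pairs with the sampled
    triples averaged out. *)
Lemma Pr_G2UG3_le_sampled (q2 q3 d : R) (t2 t3 : nat) : 0 < d ->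
  0 <= q2 <= 1 -> 0 <= q3 <= 1 ->
  q2 = 0 \/ 'C(n, 2)%:R * q2 + 2 * d <= t2%:R - t2%:R ^+ 2 / 'C(n, 2)%:R ->
  q3 = 0 \/ 'C(n, 3)%:R * q3 + 2 * d <= t3%:R - t3%:R ^+ 2 / 'C(n, 3)%:R ->
  Pr_G2UG3 q2 q3 A <=
  \sum_e2 unif_law R e2 * \sum_e3 unif_law R e3 * (@sampled_graph _ t2 t3 e2 e3 \in A)%:R
  + (2 * t2%:R / d ^+ 2 + 2 * t3%:R / d ^+ 2).
Proof.
move=> d0 q2_01 q3_01; rewrite -[n in 'C(n, 2)]card_ord -[n in 'C(n, 3)]card_ord.
rewrite -!card_kset => q2t q3t.
have K2 : (0 < #|{: kset 'I_n 2}|)%N by rewrite card_kset card_ord bin_gt0 ltnW.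
have K3 : (0 < #|{: kset 'I_n 3}|)%N by rewrite card_kset card_ord bin_gt0.
have b0 B : 0 <= bernoulli_law (fun _ : kset 'I_n 2 => q2) B by exact: bernoulli_law_ge0.
rewrite Pr_G2UG3E.
pose G B2 := \sum_(e3 : {ffun 'I_t3 -> kset 'I_n 3}) unif_law R e3 * inA B2 (e3 @: [set: 'I_t3]).
have u0 := @unif_law_ge0 R (kset 'I_n 3) t3.
apply: (@le_trans _ _ (\sum_B2 bernoulli_law (fun=> q2) B2 * (G B2 + 2 * t3%:R / d ^+ 2))).
  apply: ler_sum => B2 _; apply: ler_wpM2l => //.
  apply: (bernoulli_le_unif K3 q3_01 d0 q3t (G := inA B2)) => // B B' BB'.
  exact: inA_mono (fintype.subxx _) BB'.
under eq_bigr do rewrite mulrDr.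
rewrite big_split /= -mulr_suml bernoulli_law_sum1 mul1r addrA lerD2r.
apply: (bernoulli_le_unif K2 q2_01 d0 q2t (G := G)).
- by move=> B B' BB'; apply: ler_sum => e3 _; rewrite ler_wpM2l ?u0 ?inA_mono ?fintype.subxx //.
- move=> B; apply/andP; split.
    by apply: sumr_ge0 => e3 _; rewrite mulr_ge0 ?u0 //; case/andP: (inA01 B (e3 @: [set: 'I_t3])).
  rewrite -(unif_law_sum1 R t3 K3); apply: ler_sum => e3 _.
  by rewrite -[leRHS]mulr1 ler_wpM2l ?u0 //; case/andP: (inA01 B (e3 @: [set: 'I_t3])).
Qed.

(** Take [floor((mu2 - d) / 2)] pairs and [floor(mu3 - d)] triples. The pairs lose [d / 2] here, 1
    by rounding and [2 * d] in [bernoulli_le_unif], whence [5 / 2 * d + 1]; the triples likewise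
    lose [3 * d + 1]. *)
Lemma Pr_G2UG3_le_RIG (c2 c3 : nat -> nat) (q2 q3 d s : R) :
  let mu2 := \sum_w binom_mean 'I_n (p w) (fun k => 2 * (c2 k)%:R) in
  let mu3 := \sum_w binom_mean 'I_n (p w) (fun k => (c3 k)%:R) in
  (forall k, 2 * c2 k + 3 * c3 k <= k)%N -> 0 < d ->
  0 <= q2 <= 1 -> 0 <= q3 <= 1 -> mu2 <= s -> mu3 <= s ->
  \sum_w binom_var 'I_n (p w) (fun k => 2 * (c2 k)%:R) <= 16 * s ->
  \sum_w binom_var 'I_n (p w) (fun k => (c3 k)%:R) <= s ->
  q2 = 0 \/ 'C(n, 2)%:R * q2 <= mu2 / 2 - 5 / 2 * d - 1 - mu2 ^+ 2 / (4 * 'C(n, 2)%:R) ->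
  q3 = 0 \/ 'C(n, 3)%:R * q3 <= mu3 - 3 * d - 1 - mu3 ^+ 2 / 'C(n, 3)%:R ->
  Pr_G2UG3 q2 q3 A <= Pr_RIG p A + 20 * s / d ^+ 2.
Proof.
move=> mu2 mu3 c23 d0 q2_01 q3_01 mu2s mu3s var2 var3 q2mu q3mu.
have mu2_ge0 : 0 <= mu2.
  by apply: sumr_ge0 => w _; rewrite -(binom_mean_cst 'I_n (p w) 0); apply: le_binom_mean.
have mu3_ge0 : 0 <= mu3.
  by apply: sumr_ge0 => w _; rewrite -(binom_mean_cst 'I_n (p w) 0); apply: le_binom_mean.
(* Truncation sends negative reals to 0, so the bound by [x] is stated only for a positive
   truncation. *)
have truncP (x y : R) : x <= y -> 0 <= y ->
    [/\ x - 1 <= (Num.truncn x)%:R, (Num.truncn x)%:R <= y &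
        ((0 < Num.truncn x)%N -> (Num.truncn x)%:R <= x)].
  move=> xy y0; have xt := truncnS_gt x; rewrite -natr1 in xt.
  have tx : 0 <= x -> (Num.truncn x)%:R <= x by move=> x0; rewrite truncn_le.
  split; first by lra.
    have [/tx tx'|x0] := leP 0 x; first exact: le_trans tx' xy.
    have -> : Num.truncn x = 0%N by apply/truncn0Pn; rewrite -ltNge; lra.
    by [].
  by rewrite truncn_gt0 => x1; apply: tx; lra.
have [] := truncP ((mu2 - d) / 2) (mu2 / 2); [by lra | by lra|].
have [] := truncP (mu3 - d) mu3; [by lra | by lra|].
set t3 := Num.truncn (mu3 - d); set t2 := Num.truncn ((mu2 - d) / 2).
move=> t3l t3u t3x t2l t2u t2x.
have q2t : q2 = 0 \/ 'C(n, 2)%:R * q2 + 2 * d <= t2%:R - t2%:R ^+ 2 / 'C(n, 2)%:R.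
  case: q2mu => [->|q2mu]; [by left | right].
  have : t2%:R ^+ 2 / 'C(n, 2)%:R <= mu2 ^+ 2 / (4 * 'C(n, 2)%:R).
    have -> : mu2 ^+ 2 / (4 * 'C(n, 2)%:R) = (mu2 / 2) ^+ 2 / 'C(n, 2)%:R.
      by field; rewrite pnatr_eq0 -lt0n bin_gt0 ltnW.
    by rewrite ler_wpM2r ?invr_ge0 // lerXn2r // nnegrE //; lra.
  by lra.
have q3t : q3 = 0 \/ 'C(n, 3)%:R * q3 + 2 * d <= t3%:R - t3%:R ^+ 2 / 'C(n, 3)%:R.
  case: q3mu => [->|q3mu]; [by left | right].
  have : t3%:R ^+ 2 / 'C(n, 3)%:R <= mu3 ^+ 2 / 'C(n, 3)%:R.
    by rewrite ler_wpM2r ?invr_ge0 // lerXn2r // nnegrE.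
  by lra.
apply: le_trans (Pr_G2UG3_le_sampled d0 q2_01 q3_01 q2t q3t) _.
have F0 : (0 < #|'I_m|)%N by rewrite card_ord.
have K2 : (0 < #|{: kset 'I_n 2}|)%N by rewrite card_kset card_ord bin_gt0 ltnW.
have K3 : (0 < #|{: kset 'I_n 3}|)%N by rewrite card_kset card_ord bin_gt0.
have := rig_ge_sampled p01 A_incr t2 t3 F0 K2 K3 c23.
pose law (B : {set 'I_n * 'I_m}) : R := bernoulli_law (fun vw : 'I_n * 'I_m => p vw.2) B.
rewrite -[\sum_(B | rig B \in A) _]/(Pr_RIG p A) => main.
apply: le_trans (lerD main (lexx _)) _; rewrite -addrA lerD2l.
have law0 B : 0 <= law B by exact: bernoulli_law_ge0.
pose P2 (B : {set 'I_n * 'I_m}) := (\sum_w c2 #|holders B w| < t2)%N.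
pose P3 (B : {set 'I_n * 'I_m}) := (\sum_w c3 #|holders B w| < t3)%N.
have bad : \sum_(B | ~~ ((t2 <= \sum_w c2 #|holders B w|) && (t3 <= \sum_w c3 #|holders B w|))%N)
    law B <= \sum_(B | P2 B) law B + \sum_(B | P3 B) law B.
  rewrite [leLHS]big_mkcond [X in _ <= X + _]big_mkcond [X in _ <= _ + X]big_mkcond.
  rewrite -big_split /=.
  apply: ler_sum => B _; rewrite negb_and -!ltnNge -/(P2 B) -/(P3 B).
  by have := law0 B; case: (P2 B); case: (P3 B) => /=; lra.
have d2 : 0 < d ^+ 2 by rewrite exprn_gt0.
have tail2 : \sum_(B | P2 B) law B <= 16 * s / d ^+ 2.
  have := @holders_tail R 'I_n 'I_m p p01 (fun k => 2 * (c2 k)%:R) P2 d d0; rewrite -/mu2 => tl.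
  apply: le_trans (tl _) _; last by rewrite ler_pM2r ?invr_gt0.
  move=> B; rewrite /P2 -mulr_sumr -natr_sum => ct.
  (* Falling short of [t2] forces [0 < t2], so [t2 <= (mu2 - d) / 2] is available. *)
  have := t2x (leq_ltn_trans (leq0n _) ct); have := ltnW ct; rewrite -(ler_nat R).
  move: (\sum_w c2 _)%N => c h1 h2; rewrite ler_normr; apply/orP; right; lra.
have tail3 : \sum_(B | P3 B) law B <= s / d ^+ 2.
  have := @holders_tail R 'I_n 'I_m p p01 (fun k => (c3 k)%:R) P3 d d0; rewrite -/mu3 => tl.
  apply: le_trans (tl _) _; last by rewrite ler_pM2r ?invr_gt0.
  move=> B; rewrite /P3 -natr_sum => ct.
  have := t3x (leq_ltn_trans (leq0n _) ct); have := ltnW ct; rewrite -(ler_nat R).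
  move: (\sum_w c3 _)%N => c h1 h2; rewrite ler_normr; apply/orP; right; lra.
apply: le_trans (lerD (le_trans bad (lerD tail2 tail3)) (lexx _)) _.
(* The 20 is [16 + 1] from the tails plus [1 + 2] from [2 t2 <= mu2] and [2 t3 <= 2 mu3]. *)
rewrite -!mulrDl ler_pM2r ?invr_gt0 //; lra.
Qed.

End FiniteComparison.

(** * Means and variances of the numbers of pairs and triples *)

Section CliqueMoments.
Variables (R : realType) (n m : nat) (p : 'I_m -> R).
Hypotheses (n_gt1 : (1 < n)%N) (p01 : forall w, 0 < p w < 1).

Let p01' w : 0 <= p w <= 1.
Proof. by have /andP[/ltW -> /ltW ->] := p01 w. Qed.

Let S1E : S1 n p = \sum_w binom_mean 'I_n (p w) (@cl_size R).
Proof. by apply: eq_bigr => w _; rewrite binom_mean_cl_size // card_ord. Qed.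

Let np_neq0 w : 2 * n%:R * p w != 0.
Proof.
have /andP[p0 _] := p01 w; apply: lt0r_neq0.
by rewrite !mulr_gt0 // ltr0n ltnW.
Qed.

Let S3E : S3 n p = \sum_w binom_mean 'I_n (p w) (@cl_odd R).
Proof.
apply: eq_bigr => w _; rewrite binom_mean_cl_odd // card_ord.
have := np_neq0 w; rewrite !mulf_eq0 !negb_or => /andP[/andP[_ nn0] pp0].
by field; rewrite nn0 pp0.
Qed.

Lemma S2E : S2 n p = S1 n p - S3 n p.
Proof.
rewrite /S1 /S3 -sumrB; apply: eq_bigr => w _; rewrite -mulrBr; congr (_ * _); ring.
Qed.

Lemma S3_ge0 : 0 <= S3 n p.
Proof. by rewrite S3E; apply: sumr_ge0 => w _; exact: binom_mean_cl_odd_ge0. Qed.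

Lemma S3_le : 3 * S3 n p <= S1 n p.
Proof. by rewrite S1E S3E mulr_sumr; apply: ler_sum => w _; exact: binom_mean_cl_odd_le. Qed.

(** Twice the number of pairs has this form, with [c = -1] when only pairs are used and [c = -3]
    when odd cliques also give a triple. *)
Let combo_mean (c : R) :
  \sum_w binom_mean 'I_n (p w) (fun k => cl_size R k + c * cl_odd R k) = S1 n p + c * S3 n p.
Proof.
rewrite S1E S3E mulr_sumr -big_split /=.
by apply: eq_bigr => w _; rewrite binom_meanD binom_meanZ.
Qed.

Let combo_var (c : R) :
  \sum_w binom_var 'I_n (p w) (fun k => cl_size R k + c * cl_odd R k) <=
  10 * S1 n p + 2 * c ^+ 2 * S3 n p.
Proof.
rewrite S1E S3E !mulr_sumr -big_split /=; apply: ler_sum => w _.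
rewrite /binom_var binom_meanD binom_meanZ.
have b0 B : 0 <= bernoulli_law (fun _ : 'I_n => p w) B by exact: bernoulli_law_ge0.
apply: le_trans (variance_sum2 b0 (fun B => cl_size R #|B|) (fun B => c * cl_odd R #|B|) _ _) _.
apply: lerD.
  rewrite -[10]/(2 * 5)%:R natrM -mulrA ler_pM2l //.
  by apply: binom_var_cl_size; rewrite ?card_ord.
rewrite -mulrA ler_pM2l //.
have -> : \sum_(B : {set 'I_n}) bernoulli_law (fun=> p w) B *
    (c * cl_odd R #|B| - c * binom_mean 'I_n (p w) (@cl_odd R)) ^+ 2 =
    c ^+ 2 * binom_var 'I_n (p w) (@cl_odd R).
  rewrite /binom_var; set e := binom_mean _ _ (@cl_odd R).
  by rewrite [RHS]mulr_sumr; apply: eq_bigr => B _; ring.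
by rewrite ler_wpM2l ?sqr_ge0 // binom_var_cl_odd.
Qed.

Variable A : {set sgraph 'I_n}.
Hypotheses (n_ge3 : (3 <= n)%N) (m_gt0 : (0 < m)%N) (A_incr : increasing A).

(** With triple probability 0 only the empty hypergraph has positive weight. *)
Lemma Pr_G2_eq (q : R) : Pr_G2 q A = Pr_G2UG3 q 0 A.
Proof.
rewrite /Pr_G2UG3 big_mkcond /= -(pair_bigA _ (fun H K =>
  if sgraphU (shadow H) (shadow K) \in A then hypergraph_law 2 q H * hypergraph_law 3 0 K
  else 0)) /= /Pr_G2 [LHS]big_mkcond. apply: eq_bigr => H _ /=.
rewrite (bigD1 finset.set0) //= big1 ?addr0.
  have -> : sgraphU (shadow H) (shadow finset.set0) = shadow H.
    by apply: val_inj;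
      rewrite -[LHS]/(edges (shadow H) :|: edges (shadow finset.set0)) shadow0 finset.setU0.
  rewrite /hypergraph_law /bernoulli_law [X in _ * X]big1 ?mulr1 // => e _.
  by rewrite inE; case: ifP; rewrite subr0.
move=> K /set0Pn[e eK]; case: ifP => // _.
rewrite [X in _ * X](_ : _ = 0) ?mulr0 //.
by rewrite /hypergraph_law /bernoulli_law (bigD1 e) //= eK; case: ifP; rewrite mul0r.
Qed.

Lemma pairs_bound (q d : R) : 0 < d -> 0 <= q <= 1 ->
  q = 0 \/ 'C(n, 2)%:R * q <=
    S2 n p / 2 - 5 / 2 * d - 1 - S2 n p ^+ 2 / (4 * 'C(n, 2)%:R) ->
  Pr_G2UG3 q 0 A <= Pr_RIG p A + 20 * S1 n p / d ^+ 2.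
Proof.
move=> d0 q01 qS; have S30 := S3_ge0; have S31 := S3_le.
(* Rounding down to an even number subtracts the parity; the corrections at [k = 1] cancel. *)
have half k : 2 * (k./2)%:R = cl_size R k + (-1) * cl_odd R k.
  rewrite /cl_size /cl_odd -[k in k%:R - _]odd_double_half natrD -mul2n natrM; ring.
have E2 : \sum_w binom_mean 'I_n (p w) (fun k => 2 * (k./2)%:R) = S2 n p.
  rewrite S2E -mulN1r -combo_mean.
  by apply: eq_bigr => w _; apply: eq_binom_mean => k; exact: half.
have E3 : \sum_w binom_mean 'I_n (p w) (fun k : nat => 0%:R) = 0.
  by rewrite big1 // => w _; exact: binom_mean_cst.
apply: (@Pr_G2UG3_le_RIG _ _ _ _ _ n_ge3 m_gt0 p01' A_incr (fun k => k./2) (fun=> 0%N)) => //.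
- by move=> k; rewrite muln0 addn0 mul2n -[leqRHS]odd_double_half leq_addl.
- by rewrite lexx ler01.
- by rewrite E2 S2E; lra.
- by rewrite E3; lra.
- apply: (@le_trans _ _ (10 * S1 n p + 2 * (-1) ^+ 2 * S3 n p)); last by lra.
  apply: le_trans (combo_var (-1)); rewrite le_eqVlt; apply/orP; left; apply/eqP.
  apply: eq_bigr => w _; rewrite /binom_var -(eq_binom_mean _ _ half).
  by apply: eq_binom_mean => k; rewrite -half.
- rewrite big1; first lra.
  by move=> w _; rewrite /binom_var !binom_mean_cst subrr expr0n.
- by rewrite E2.
- by left.
Qed.

Lemma pairs_triples_bound (q2 q3 d : R) : 0 < d -> 0 <= q2 <= 1 -> 0 <= q3 <= 1 ->
  let mu2 := S1 n p - 3 * S3 n p in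
  q2 = 0 \/ 'C(n, 2)%:R * q2 <= mu2 / 2 - 5 / 2 * d - 1 - mu2 ^+ 2 / (4 * 'C(n, 2)%:R) ->
  q3 = 0 \/ 'C(n, 3)%:R * q3 <= S3 n p - 3 * d - 1 - S3 n p ^+ 2 / 'C(n, 3)%:R ->
  Pr_G2UG3 q2 q3 A <= Pr_RIG p A + 20 * S1 n p / d ^+ 2.
Proof.
move=> d0 q2_01 q3_01 mu2 q2S q3S; have S30 := S3_ge0; have S31 := S3_le.
pose c3 k := (odd k && (k != 1)) : nat.
(* Truncated subtraction gives [c2 1 = 0]; an odd [k >= 3] reserves three vertices for its
   triple. *)
pose c2 k := ((k - 3 * (odd k))./2)%N.
have c3E k : (c3 k)%:R = cl_odd R k by rewrite cl_odd_bool.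
have c2E k : 2 * (c2 k)%:R = cl_size R k + (-3) * cl_odd R k.
  have [->|k1] := eqVneq k 1%N; first by rewrite /cl_size /cl_odd /c2 /=; ring.
  have -> : cl_size R k + -3 * cl_odd R k = (k - 3 * odd k)%N%:R.
    rewrite /cl_size cl_odd_bool k1 andbT (negbTE k1) subr0 natrB ?natrM; first ring.
    by case: k k1 => [|[|[|k]]] //; case: (odd _).
  have ev : odd (k - 3 * odd k) = false.
    by case: k k1 => [|[|[|k]]] //= _; case: (boolP (odd k)) => /= ok;
      rewrite ?subn0 /= ?ok //; lia.
  by rewrite /c2 -[in RHS](odd_double_half (k - 3 * odd k)) ev add0n -mul2n natrM.
have E2 : \sum_w binom_mean 'I_n (p w) (fun k => 2 * (c2 k)%:R) = mu2.
  rewrite /mu2 -mulNr -combo_mean.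
  by apply: eq_bigr => w _; apply: eq_binom_mean => k; exact: c2E.
have E3 : \sum_w binom_mean 'I_n (p w) (fun k => (c3 k)%:R) = S3 n p.
  by rewrite S3E; apply: eq_bigr => w _; apply: eq_binom_mean => k; exact: c3E.
apply: (@Pr_G2UG3_le_RIG _ _ _ _ _ n_ge3 m_gt0 p01' A_incr c2 c3) => //.
- rewrite /c2 /c3; case=> [|[|[|k]]] //; lia.
- by rewrite E2 /mu2; lra.
- by rewrite E3; lra.
(* Since [3 S3 <= S1], this is at most [(10 + 6) S1], the origin of the constant 16. *)
- apply: (@le_trans _ _ (10 * S1 n p + 2 * (-3) ^+ 2 * S3 n p)); last by lra.
  apply: le_trans (combo_var (-3)); rewrite le_eqVlt; apply/orP; left; apply/eqP.
  apply: eq_bigr => w _; rewrite /binom_var -(eq_binom_mean _ _ c2E).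
  by apply: eq_binom_mean => k; rewrite -c2E.
- apply: (@le_trans _ _ (S3 n p)); last by lra.
  rewrite S3E; apply: ler_sum => w _.
  apply: le_trans (binom_var_cl_odd 'I_n (p01' w)); rewrite le_eqVlt; apply/orP; left; apply/eqP.
  rewrite /binom_var -(eq_binom_mean _ _ c3E).
  by apply: eq_binom_mean => k; rewrite -c3E.
- by rewrite E2.
- by rewrite E3.
Qed.

End CliqueMoments.

(** * Limits *)

Section Asymptotics.
Variable R : realType.

(** For [k] beyond [i], [j] and the threshold of [e]: [infs u i <= u k <= v k + e <= sups v j +
    e]. *)
Lemma limn_inf_le_sup (u v : nat -> R) :
  (forall n, 0 <= u n <= 1) -> (forall n, 0 <= v n <= 1) ->
  (forall e, 0 < e -> exists N, forall n, (N <= n)%N -> u n <= v n + e) ->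
  limn_inf u <= limn_sup v.
Proof.
move=> u01 v01 uv.
have bnd (w : nat -> R) : (forall n, 0 <= w n <= 1) -> bounded_fun (w : nat -> R^o).
  move=> w01; exists 1; split; first exact: num_real.
  move=> M M1 n _ /=; have /andP[w0 w1] := w01 n.
  by rewrite ger0_norm // (le_trans w1) // ltW.
rewrite (limn_infE (bnd u u01)) (limn_supE (bnd v v01)).
have key i j : infs u i <= sups v j.
  apply/ler_addgt0Pr => e /uv[N uvN]; pose k := maxn N (maxn i j).
  have ki : infs u i <= u k.
    apply: ge_inf; last by exists k => //=; rewrite /k !leq_max leqnn !orbT.
    by exists 0 => _ [l _ <-]; case/andP: (u01 l).
  have kj : v k <= sups v j.
    apply: ub_le_sup; last by exists k => //=; rewrite /k !leq_max leqnn !orbT.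
    by exists 1 => _ [l _ <-]; case/andP: (v01 l).
  apply: (le_trans ki); apply: le_trans (uvN k _) _; first by rewrite leq_maxl.
  by rewrite lerD2r.
apply: ge_sup; first by exists (infs u 0), 0%N.
move=> _ [i _ <-]; apply: lb_le_inf; first by exists (sups v 0), 0%N.
by move=> _ [j _ <-].
Qed.

Lemma clamp01_bound (x : R) : 0 <= clamp01 x <= 1.
Proof.
rewrite /clamp01 le_max lexx /= ge_max ler01 /=.
by rewrite ge_min lexx orbT.
Qed.

(** These are the two alternatives in the hypotheses on [q2] and [q3]. *)
Lemma clamp01_cases (x : R) : clamp01 x = 0 \/ clamp01 x <= x.
Proof.
rewrite /clamp01; have [x0|x0] := leP x 0.
  by left; rewrite max_l // ge_min x0.
by right; rewrite ge_max (ltW x0) ge_min lexx.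
Qed.

Lemma bernoulli_law_prob (T : finType) (q : T -> R) (P : pred {set T}) :
  (forall x, 0 <= q x <= 1) -> 0 <= \sum_(B | P B) bernoulli_law q B <= 1.
Proof.
move=> q01; have law0 B : 0 <= bernoulli_law q B by exact: bernoulli_law_ge0.
rewrite sumr_ge0 //= -(bernoulli_law_sum1 q) big_mkcond.
by apply: ler_sum => B _; case: ifP.
Qed.

Lemma Pr_G2UG3_01 n (q2 q3 : R) (A : {set sgraph 'I_n}) :
  0 <= q2 <= 1 -> 0 <= q3 <= 1 -> 0 <= Pr_G2UG3 q2 q3 A <= 1.
Proof.
move=> q2_01 q3_01.
have h01 (i : nat) (q : R) : 0 <= q <= 1 ->
    (forall e : {set 'I_n}, 0 <= (if #|e| == i then q else 0 : R) <= 1).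
  by move=> q01 e; case: ifP => _ //; rewrite lexx ler01.
have law0 (i : nat) (q : R) (H : {set {set 'I_n}}) : 0 <= q <= 1 ->
    0 <= hypergraph_law (n := n) i q H.
  by move=> q01; apply: bernoulli_law_ge0 => e; exact: h01.
rewrite /Pr_G2UG3; apply/andP; split.
  by apply: sumr_ge0 => HK _; rewrite mulr_ge0 ?law0.
rewrite big_mkcond; apply: (@le_trans _ _ (\sum_H \sum_K hypergraph_law (n := n) 2 q2 H
    * hypergraph_law (n := n) 3 q3 K)).
  rewrite pair_bigA; apply: ler_sum => HK _ /=.
  by case: ifP => _ //; rewrite mulr_ge0 ?law0.
under eq_bigr do rewrite -mulr_sumr bernoulli_law_sum1 mulr1.
by rewrite bernoulli_law_sum1.
Qed.

Lemma bin2_ge n : (2 <= n)%N -> n%:R ^+ 2 <= 4 * 'C(n, 2)%:R :> R.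
Proof.
move=> n2; rewrite -natrX -natrM ler_nat.
have := bin_ffact n 2; rewrite !ffactnS ffactn0 -[2`!]/2%N; nia.
Qed.

Lemma bin3_ge n : (4 <= n)%N -> n%:R ^+ 3 <= 16 * 'C(n, 3)%:R :> R.
Proof.
move=> n4; rewrite -natrX -natrM ler_nat.
have := bin_ffact n 3; rewrite !ffactnS ffactn0 -[3`!]/6%N.
have [k ->] : exists k, n = (k + 4)%N by exists (n - 4)%N; rewrite subnK.
move: ('C(_, 3)) => b; rewrite !addnS addn0 /=; nia.
Qed.

End Asymptotics.

(** * The edge probabilities of the theorem, for fixed [n] *)

Section Thresholds.
Variables (R : realType) (n m : nat) (p : 'I_m -> R) (A : {set sgraph 'I_n}) (C omega : R).
Hypotheses (n_ge4 : (4 <= n)%N) (m_gt0 : (0 < m)%N) (p01 : forall w, 0 < p w < 1).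
Hypotheses (A_incr : increasing A) (C_gt0 : 0 < C).
Let s1 : R := S1 n p.
Let s2 : R := S2 n p.
Let s3 : R := S3 n p.
Let r : R := Num.sqrt s1.
Hypothesis s1_ge1 : 1 <= s1.

Let n1 : (1 < n)%N. Proof. exact: leq_trans n_ge4. Qed.
Let n3 : (3 <= n)%N. Proof. exact: leq_trans n_ge4. Qed.

Let r_ge1 : 1 <= r.
Proof. by rewrite -[1]sqrtr1 ler_wsqrtr. Qed.

Let r_sqr : r ^+ 2 = s1.
Proof. by rewrite sqr_sqrtr // (le_trans ler01). Qed.

Let bounds : [/\ 0 < C, 1 <= s1 & 1 <= r] /\ [/\ 0 <= s3, 3 * s3 <= s1 & s2 = s1 - s3].
Proof.
split; split=> //; [exact: S3_ge0 | exact: S3_le | exact: S2E].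
Qed.

Let N2_gt0 : 0 < 'C(n, 2)%:R :> R.
Proof. by rewrite ltr0n bin_gt0 ltnW. Qed.

Let N3_gt0 : 0 < 'C(n, 3)%:R :> R.
Proof. by rewrite ltr0n bin_gt0. Qed.

Let n_gt0 : 0 < n%:R :> R.
Proof. by rewrite ltr0n (leq_trans _ n_ge4). Qed.

Let d_gt0 : 0 < C * r.
Proof. by rewrite mulr_gt0 // (lt_le_trans ltr01). Qed.

(** The deviation [d = C r], with [r] the square root of [S1], makes the error independent of
    [n]. *)
Let error_term : 20 * s1 / (C * r) ^+ 2 = 20 / C ^+ 2.
Proof.
rewrite exprMn r_sqr; field.
by rewrite (gt_eqF C_gt0) (gt_eqF (lt_le_trans ltr01 s1_ge1)).
Qed.

Let clamp01_mul (c N x : R) : 0 < c -> 0 < N ->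
  clamp01 (x / (c * N)) = 0 \/ N * clamp01 (x / (c * N)) <= x / c.
Proof.
move=> c0 N0; have [->|le] := clamp01_cases (x / (c * N)); [by left | right].
have -> : x / c = N * (x / (c * N)) by field; rewrite !gt_eqF.
by rewrite ler_pM2l.
Qed.

Let pair_collisions (x y : R) : 0 <= x <= y -> x ^+ 2 / (4 * 'C(n, 2)%:R) <= y ^+ 2 * n%:R ^- 2.
Proof.
move=> /andP[x0 xy]; apply: ler_pM; rewrite ?sqr_ge0 ?invr_ge0 ?mulr_ge0 ?(ltW N2_gt0) //.
  by rewrite lerXn2r // nnegrE // (le_trans x0).
by rewrite lef_pV2 ?posrE ?exprn_gt0 ?mulr_gt0 // bin2_ge.
Qed.

(** As [S2 >= S1 / 4], its square root is at least [r / 2], so [omega] times it is at least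
    [5 C r + 2 r]. Half of this covers [5 / 2 * d] and, as [r >= 1], the rounding unit. *)
Lemma Pr_G2_le_RIG :
  10 * C + 4 <= omega ->
  Pr_G2 (clamp01 ((s2 - omega * Num.sqrt s2 - 2 * s2 ^+ 2 * n%:R ^- 2) / (2 * 'C(n, 2)%:R))) A
  <= Pr_RIG p A + 20 / C ^+ 2.
Proof.
have [[C0 s11 r1] [s3_ge0 s3_le s2E]] := bounds; move=> om; rewrite Pr_G2_eq -error_term.
apply: (pairs_bound n1 p01 n3 m_gt0 A_incr d_gt0 (clamp01_bound _)); rewrite -/s2.
have [->|le] := clamp01_mul (s2 - omega * Num.sqrt s2 - 2 * s2 ^+ 2 * n%:R ^- 2)
  (ltr0n R 2) N2_gt0; [by left | right].
apply: (le_trans le).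
have rs2 : r / 2 <= Num.sqrt s2.
  have -> : r / 2 = Num.sqrt (s1 / 4).
    rewrite sqrtrM ?(le_trans ler01) //; congr (_ * _).
    by rewrite -[4]/((2 * 2)%:R) natrM -expr2 -exprVn sqrtr_sqr ger0_norm ?invr_ge0.
  by apply: ler_wsqrtr; rewrite s2E; lra.
have prod : (10 * C + 4) * (r / 2) <= omega * Num.sqrt s2.
  by apply: ler_pM => //; lra.
have := @pair_collisions s2 s2; rewrite lexx andbT => /(_ ltac:(rewrite s2E; lra)).
have : (10 * C + 4) * (r / 2) = 5 * (C * r) + 2 * r by field.
have := r_ge1. lra.
Qed.

(** Pairs alone suffice: replacing [S2] by [S1 = S2 + S3] costs at most [K r], which [omega r]
    absorbs. *)
Lemma Pr_G2UG3_0_le_RIG (K : R) : s3 <= K * r -> K + 5 * C + 2 <= omega ->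
  Pr_G2UG3 (clamp01 ((s1 - omega * r - 2 * s1 ^+ 2 * n%:R ^- 2) / (2 * 'C(n, 2)%:R)))
    (clamp01 0) A <= Pr_RIG p A + 20 / C ^+ 2.
Proof.
have [[C0 s11 r1] [s3_ge0 s3_le s2E]] := bounds.
move=> s3K om; rewrite -error_term [clamp01 0]clamp01_id ?lexx ?ler01 //.
apply: (pairs_bound n1 p01 n3 m_gt0 A_incr d_gt0 (clamp01_bound _)); rewrite -/s2.
have [->|le] := clamp01_mul (s1 - omega * r - 2 * s1 ^+ 2 * n%:R ^- 2)
  (ltr0n R 2) N2_gt0; [by left | right].
apply: (le_trans le).
have prod : (K + 5 * C + 2) * r <= omega * r by rewrite ler_wpM2r // (le_trans ler01).
have := @pair_collisions s2 s1 ltac:(rewrite s2E; lra).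
have : (K + 5 * C + 2) * r = K * r + 5 * (C * r) + 2 * r by ring.
lra.
Qed.

Hypothesis s1_le : s1 <= n%:R ^+ 2.

(** From [3 S3 <= r^2] and [r <= n]: [S3^2 <= r^4 / 9 <= r n^3 / 9], at most [16 / 9] times
    [r 'C(n, 3)]. The collisions can thus be charged to [omega r]. *)
Let triple_collisions : s3 ^+ 2 / 'C(n, 3)%:R <= 2 * r.
Proof.
have [[_ s11 r1] [s3_ge0 s3_le _]] := bounds; rewrite ler_pdivrMr //; have rn : r <= n%:R.
  by rewrite -(ger0_norm (ltW n_gt0)) -sqrtr_sqr ler_wsqrtr.
have r0 : 0 <= r by rewrite (le_trans ler01).
have h1 : s3 ^+ 2 <= (s1 / 3) ^+ 2.
  by rewrite lerXn2r // ?nnegrE //; lra.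
have h2 : r * r ^+ 3 <= r * n%:R ^+ 3.
  by rewrite ler_wpM2l // lerXn2r // nnegrE ltW.
have h3 : r * n%:R ^+ 3 <= r * (16 * 'C(n, 3)%:R) by rewrite ler_wpM2l // bin3_ge.
have -> : 2 * r * 'C(n, 3)%:R = (r * (16 * 'C(n, 3)%:R)) / 8 by field.
have e : (s1 / 3) ^+ 2 = (r * r ^+ 3) / 9 by rewrite -r_sqr; field.
have : 0 <= r * r ^+ 3 by rewrite mulr_ge0 // exprn_ge0.
lra.
Qed.

(** Pairs require [5 C + 2]; triples require [3 C + 3], for [3 d], the rounding unit and the
    collisions. The bound covers both. *)
Lemma Pr_G2UG3_le_RIG_omega : 5 * C + 3 <= omega ->
  Pr_G2UG3 (clamp01 ((s1 - 3 * s3 - omega * r - 2 * s1 ^+ 2 * n%:R ^- 2) / (2 * 'C(n, 2)%:R)))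
    (clamp01 ((s3 - omega * r - 6 * s3 ^+ 2 * n%:R ^- 3) / 'C(n, 3)%:R)) A
  <= Pr_RIG p A + 20 / C ^+ 2.
Proof.
have [[C0 s11 r1] [s3_ge0 s3_le s2E]] := bounds; move=> om; rewrite -error_term.
have prod : (5 * C + 3) * r <= omega * r by rewrite ler_wpM2r // (le_trans ler01).
have prodE : (5 * C + 3) * r = 5 * (C * r) + 3 * r by ring.
have d0 := d_gt0.
apply: (pairs_triples_bound n1 p01 n3 m_gt0 A_incr d_gt0 (clamp01_bound _) (clamp01_bound _));
  rewrite -/s1 -/s3.
- have [->|le] := clamp01_mul (s1 - 3 * s3 - omega * r - 2 * s1 ^+ 2 * n%:R ^- 2)
    (ltr0n R 2) N2_gt0; [by left | right].
  apply: (le_trans le).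
  by have := @pair_collisions (s1 - 3 * s3) s1 ltac:(lra); lra.
- rewrite -['C(n, 3)%:R]mul1r.
  have [->|le] := clamp01_mul (s3 - omega * r - 6 * s3 ^+ 2 * n%:R ^- 3)
    ltr01 N3_gt0; [by left | right].
  rewrite {1}mul1r; apply: (le_trans le); rewrite mul1r divr1.
  have : 0 <= s3 ^+ 2 * n%:R ^- 3 by rewrite mulr_ge0 ?sqr_ge0 // invr_ge0 exprn_ge0 // ltW.
  by have := triple_collisions; lra.
Qed.

End Thresholds.

(** * Passage to the limit *)

Unset Implicit Arguments.
Local Open Scope classical_set_scope.
Local Open Scope ring_scope.

Theorem theorem1 (R : realType) (m : nat -> nat)
    (p : forall n : nat, 'I_(m n) -> R) (omega : nat -> R)
    (m_gt0 : forall n : nat, (0 < m n)%N)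
    (p01 : forall (n : nat) (i : 'I_(m n)), 0 < p n i < 1)
    (omega_infty : omega n @[n --> \oo] --> +oo) :
  let s1 := fun n : nat => S1 n (p n) in
  let s2 := fun n : nat => S2 n (p n) in
  let s3 := fun n : nat => S3 n (p n) in
  let sqrt_s1 := fun n : nat => Num.sqrt (s1 n) in
  forall (s1_infty : s1 n @[n --> \oo] --> +oo)
    (s1_small : (s1 : nat -> R^o) =o_\oo ((fun n => n%:R ^+ 2) : nat -> R^o))
    (A : forall n : nat, {set sgraph 'I_n})
    (A_property : forall n : nat, graph_property (A n))
    (A_increasing : forall n : nat, increasing (A n)),
  [/\ (let phat := fun n : nat =>
         (s2 n - omega n * Num.sqrt (s2 n) - 2 * s2 n ^+ 2 * n%:R ^- 2)
         / (2 * 'C(n, 2)%:R) in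
       limn_inf (fun n => Pr_G2 (clamp01 (phat n)) (A n))
         <= limn_sup (fun n => Pr_RIG (p n) (A n))),
      ((sqrt_s1 : nat -> R^o) =o_\oo (s3 : nat -> R^o) ->
       ((fun n => omega n ^+ 2) : nat -> R^o)
         =o_\oo ((fun n => s3 n / sqrt_s1 n) : nat -> R^o) ->
       let phat2 := fun n : nat =>
         (s1 n - 3 * s3 n - omega n * Num.sqrt (s1 n)
            - 2 * s1 n ^+ 2 * n%:R ^- 2)
         / (2 * 'C(n, 2)%:R) in
       let phat3 := fun n : nat =>
         (s3 n - omega n * Num.sqrt (s1 n) - 6 * s3 n ^+ 2 * n%:R ^- 3)
         / 'C(n, 3)%:R in
       limn_inf (fun n => Pr_G2UG3 (clamp01 (phat2 n)) (clamp01 (phat3 n)) (A n))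
         <= limn_sup (fun n => Pr_RIG (p n) (A n)))
    & ((s3 : nat -> R^o) =O_\oo (sqrt_s1 : nat -> R^o) ->
       let phat2 := fun n : nat =>
         (s1 n - omega n * Num.sqrt (s1 n) - 2 * s1 n ^+ 2 * n%:R ^- 2)
         / (2 * 'C(n, 2)%:R) in
       let phat3 := fun n : nat => (0 : R) in
       limn_inf (fun n => Pr_G2UG3 (clamp01 (phat2 n)) (clamp01 (phat3 n)) (A n))
         <= limn_sup (fun n => Pr_RIG (p n) (A n)))].
Proof.
move=> s1 s2 s3 sqrt_s1 s1_infty s1_small A _ A_incr.
have p01' n w : 0 <= p n w <= 1 by have /andP[/ltW -> /ltW ->] := p01 n w.
have rig01 n : 0 <= Pr_RIG (p n) (A n) <= 1.
  by apply: bernoulli_law_prob => vw; exact: p01'.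
(* Common reduction of the three claims: [L C] is the size of [omega] that brings the error down to
   [20 / C^2], and it is eventually exceeded. *)
have main (L : R -> R) (u : nat -> R) : (forall n, 0 <= u n <= 1) ->
    (exists N0, forall n C, (N0 <= n)%N -> (4 <= n)%N -> 0 < C -> 1 <= s1 n ->
      s1 n <= n%:R ^+ 2 -> L C <= omega n -> u n <= Pr_RIG (p n) (A n) + 20 / C ^+ 2) ->
    limn_inf u <= limn_sup (fun n => Pr_RIG (p n) (A n)).
  move=> u01 [N0 step]; apply: limn_inf_le_sup => // e e0.
  (* Chosen so that [20 / C^2 = e]. *)
  pose C := Num.sqrt (20 / e).
  have C0 : 0 < C by rewrite sqrtr_gt0 divr_gt0.
  have eC : 20 / C ^+ 2 = e.
    by rewrite sqr_sqrtr ?ltW ?divr_gt0 // invf_div mulrC divfK.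
  have [N1 _ N1P] : \forall n \near \oo, L C <= omega n.
    by move/cvgryPge: omega_infty; apply.
  have [N2 _ N2P] : \forall n \near \oo, 1 <= s1 n.
    by move/cvgryPge: s1_infty; apply.
  have [N3 _ N3P] : \forall n \near \oo, `|s1 n| <= 1 * `|n%:R ^+ 2 : R|.
    by move/eqoP: s1_small; apply.
  exists (N0 + N1 + N2 + N3 + 4)%N => n nN; rewrite -eC.
  have s1n : 1 <= s1 n by apply: N2P => /=; lia.
  apply: step => //; [by lia | by lia | | by apply: N1P => /=; lia].
  have := N3P n; rewrite /= mul1r => /(_ ltac:(lia)).
  by rewrite !ger0_norm ?exprn_ge0 // (le_trans ler01).
split.
- apply: (main (fun C => 10 * C + 4)) => [n|].
    by rewrite Pr_G2_eq; apply: Pr_G2UG3_01; rewrite ?clamp01_bound // lexx ler01.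
  exists 0%N => n C _ n4 C0 s1n _ om.
  exact: (Pr_G2_le_RIG n4 (m_gt0 n) (p01 n) (A_incr n) C0 s1n om).
- move=> _ _; apply: (main (fun C => 5 * C + 3)) => [n|].
    by apply: Pr_G2UG3_01; exact: clamp01_bound.
  exists 0%N => n C _ n4 C0 s1n s1n2 om.
  exact: (Pr_G2UG3_le_RIG_omega n4 (m_gt0 n) (p01 n) (A_incr n) C0 s1n s1n2 om).
(* The constant [K] of the [O] bound enters the required size of [omega]. *)
- move=> /eqO_exP[K K0 [N0 _ N0P]].
  apply: (main (fun C => K + 5 * C + 2)) => [n|].
    by apply: Pr_G2UG3_01; exact: clamp01_bound.
  exists N0 => n C nN0 n4 C0 s1n _ om.
  apply: (Pr_G2UG3_0_le_RIG n4 (m_gt0 n) (p01 n) (A_incr n) C0 s1n _ om).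
  apply: le_trans (ler_norm _) _; apply: le_trans (N0P n nN0) _.
  by rewrite ger0_norm // sqrtr_ge0.
Qed.
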